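(* Let $F$ be a field, let $D$ be a subring of $F$, and let $\mathfrak{X}$ be the Zariski-Riemann space of $F/D$. Let $Z$ be a nonempty subspace of $\mathfrak{X}$. Then $(Z,\mathcal{O}_Z)$ is an affine scheme if and only if $Z$ is inverse closed in $\mathfrak{X}$ and $\mathcal{O}_Z(Z)=\bigcap_{V\in Z}V$ is a Prüfer domain with quotient field $F$.
   Context: The Zariski-Riemann space $\mathfrak{X}$ of $F/D$ is the set of all valuation rings $V$ with $D\subseteq V\subseteq F$ having quotient field $F$ ($F$ itself is allowed), with the topology having as a basis of open sets the sets $\mathfrak{X}_S=\{V\in\mathfrak{X}: S\subseteq V\}$, $S$ a finite subset of $F$ (Zariski topology); it is a spectral space. A subset of $\mathfrak{X}$ is inverse closed if it equals the intersection of all quasicompact open subsets of $\mathfrak{X}$ containing it. A subset $Z$ of $\mathfrak{X}$ carries the subspace topology, and $\mathcal{O}_Z$ is the presheaf given by $\mathcal{O}_Z(U)=\bigcap_{V\in U}V$ for nonempty open $U\subseteq Z$, $\mathcal{O}_Z(\emptyset)=F$, with inclusions as restriction maps between nonempty open sets; $(Z,\mathcal{O}_Z)$ being an affine scheme means that this is a locally ringed space (with stalk $V$ at $V\in Z$) isomorphic to the spectrum of a ring. A domain is a Prüfer domain if all its localizations at prime ideals are valuation rings. All rings are commutative with identity.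
   Formalization: Since O_Z(∅)=F is not the zero ring, (Z,O_Z) would literally never be an affine scheme; here the sheaf axiom (covers, overlap conditions) and the isomorphism with the spectrum of a ring are required only over nonempty open sets. *)

(* Defs.v *)
From HB Require Import structures.
From mathcomp Require Import all_boot all_order all_algebra.
From mathcomp Require Import generic_quotient ring.
From mathcomp Require Import mathcomp_extra boolp classical_sets functions.
From mathcomp Require Import cardinality topology.

Set Implicit Arguments.
Unset Strict Implicit.
Unset Printing Implicit Defensive.

Import GRing.Theory.

Local Open Scope classical_set_scope.
Local Open Scope quotient_scope.
Local Open Scope ring_scope.

Record subring (R : comPzRingType) := Subring {
  subring_set :> R -> Prop;
  subringP : subring_closed [in subring_set : set R] }.

Section SubringTheory.
Variables (R : comPzRingType) (A : subring R).

Definition subring_pred : {pred R} := [in subring_set A : set R].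

HB.instance Definition _ :=
  GRing.isSubringClosed.Build R subring_pred (subringP A).

Definition subring_type : Type := {x : R | subring_pred x}.

HB.instance Definition _ := SubChoice.on subring_type.
HB.instance Definition _ := GRing.SubChoice_isSubComPzRing.Build
  R subring_pred subring_type (subringP A).

Lemma subring_typeP (x : subring_type) : A (val x).
Proof. exact: set_mem (valP x). Qed.

Definition subring_elt (x : R) (Ax : A x) : subring_type :=
  Sub x (mem_set Ax : subring_pred x).

Lemma subring1 : A 1.
Proof. by case: (subringP A) => + _ _; rewrite !inE. Qed.

Lemma subringB x y : A x -> A y -> A (x - y).
Proof.
by case: (subringP A) => _ /(_ x y) + _ => AB Ax Ay; move: AB; rewrite !inE; apply.
Qed.

Lemma subringM x y : A x -> A y -> A (x * y).
Proof.
by case: (subringP A) => _ _ /(_ x y) AM Ax Ay; move: AM; rewrite !inE; apply.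
Qed.

End SubringTheory.

Coercion subring_type : subring >-> Sortclass.

Lemma subring_closedP (R : comPzRingType) (A : set R) :
  A 1 -> (forall x y, A x -> A y -> A (x - y)) ->
  (forall x y, A x -> A y -> A (x * y)) -> subring_closed [in A].
Proof.
move=> A1 AB AM; split=> [|x y|x y]; rewrite !inE; [exact: A1|exact: AB|exact: AM].
Qed.

(* The data of a commutative ring "up to" an equivalence relation; both
   localizations and stalks are quotients of such data. *)
Record prering := PreRing {
  pr_sort :> Type;
  pr_eqv : pr_sort -> pr_sort -> Prop;
  pr_zero : pr_sort;
  pr_one : pr_sort;
  pr_opp : pr_sort -> pr_sort;
  pr_add : pr_sort -> pr_sort -> pr_sort;
  pr_mul : pr_sort -> pr_sort -> pr_sort;
  pr_refl : forall x, pr_eqv x x;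
  pr_sym : forall x y, pr_eqv x y -> pr_eqv y x;
  pr_trans : forall x y z, pr_eqv x y -> pr_eqv y z -> pr_eqv x z;
  pr_opp_eqv : forall x x', pr_eqv x x' -> pr_eqv (pr_opp x) (pr_opp x');
  pr_add_eqv : forall x x' y y',
    pr_eqv x x' -> pr_eqv y y' -> pr_eqv (pr_add x y) (pr_add x' y');
  pr_mul_eqv : forall x x' y y',
    pr_eqv x x' -> pr_eqv y y' -> pr_eqv (pr_mul x y) (pr_mul x' y');
  pr_addA : forall x y z,
    pr_eqv (pr_add x (pr_add y z)) (pr_add (pr_add x y) z);
  pr_addC : forall x y, pr_eqv (pr_add x y) (pr_add y x);
  pr_add0 : forall x, pr_eqv (pr_add pr_zero x) x;
  pr_addN : forall x, pr_eqv (pr_add (pr_opp x) x) pr_zero;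
  pr_mulA : forall x y z,
    pr_eqv (pr_mul x (pr_mul y z)) (pr_mul (pr_mul x y) z);
  pr_mulC : forall x y, pr_eqv (pr_mul x y) (pr_mul y x);
  pr_mul1 : forall x, pr_eqv (pr_mul pr_one x) x;
  pr_mulD : forall x y z,
    pr_eqv (pr_mul (pr_add x y) z) (pr_add (pr_mul x z) (pr_mul y z)) }.

HB.instance Definition _ (P : prering) := gen_eqMixin (pr_sort P).
HB.instance Definition _ (P : prering) := gen_choiceMixin (pr_sort P).

Section QuotRing.
Variable P : prering.

Definition pr_eqvb (x y : P) : bool := `[< pr_eqv x y >].

Lemma pr_eqvb_refl : reflexive pr_eqvb.
Proof. by move=> x; apply/asboolP/pr_refl. Qed.

Lemma pr_eqvb_sym : symmetric pr_eqvb.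
Proof. by move=> x y; apply/asboolP/asboolP => /pr_sym. Qed.

Lemma pr_eqvb_trans : transitive pr_eqvb.
Proof. by move=> y x z /asboolP xy /asboolP yz; apply/asboolP/(pr_trans xy). Qed.

Canonical pr_eqvb_equiv := EquivRel pr_eqvb pr_eqvb_refl pr_eqvb_sym pr_eqvb_trans.

Definition quot_ring := {eq_quot pr_eqvb}.

HB.instance Definition _ := EqQuotient.on quot_ring.
HB.instance Definition _ := Choice.on quot_ring.

Definition quot_class (x : P) : quot_ring := \pi x.

Lemma quot_classP (x y : P) : quot_class x = quot_class y <-> pr_eqv x y.
Proof.
split=> [/eqmodP/asboolP //|xy].
by apply/eqmodP/asboolP.
Qed.

Lemma quot_class_repr (x : quot_ring) : quot_class (repr x) = x.
Proof. exact: reprK. Qed.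

Lemma repr_quot_class (x : P) : pr_eqv (repr (quot_class x)) x.
Proof. by apply/quot_classP; rewrite quot_class_repr. Qed.

Definition quot_opp (x : quot_ring) := quot_class (pr_opp (repr x)).
Definition quot_add (x y : quot_ring) := quot_class (pr_add (repr x) (repr y)).
Definition quot_mul (x y : quot_ring) := quot_class (pr_mul (repr x) (repr y)).

Lemma quot_oppE x : quot_opp (quot_class x) = quot_class (pr_opp x).
Proof. by apply/quot_classP/pr_opp_eqv/repr_quot_class. Qed.

Lemma quot_addE x y :
  quot_add (quot_class x) (quot_class y) = quot_class (pr_add x y).
Proof. by apply/quot_classP/pr_add_eqv; apply: repr_quot_class. Qed.

Lemma quot_mulE x y :
  quot_mul (quot_class x) (quot_class y) = quot_class (pr_mul x y).
Proof. by apply/quot_classP/pr_mul_eqv; apply: repr_quot_class. Qed.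

Lemma quot_ind (Q : quot_ring -> Prop) :
  (forall x, Q (quot_class x)) -> forall x, Q x.
Proof. by move=> QP x; rewrite -(quot_class_repr x). Qed.

Fact quot_addA : associative quot_add.
Proof.
elim/quot_ind=> x; elim/quot_ind=> y; elim/quot_ind=> z.
by rewrite !quot_addE; apply/quot_classP/pr_addA.
Qed.

Fact quot_addC : commutative quot_add.
Proof.
elim/quot_ind=> x; elim/quot_ind=> y.
by rewrite !quot_addE; apply/quot_classP/pr_addC.
Qed.

Fact quot_add0 : left_id (quot_class (pr_zero P)) quot_add.
Proof.
by elim/quot_ind=> x; rewrite !quot_addE; apply/quot_classP/pr_add0.
Qed.

Fact quot_addN : left_inverse (quot_class (pr_zero P)) quot_opp quot_add.
Proof.
elim/quot_ind=> x.
by rewrite quot_oppE quot_addE; apply/quot_classP/pr_addN.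
Qed.

HB.instance Definition _ :=
  GRing.isZmodule.Build quot_ring quot_addA quot_addC quot_add0 quot_addN.

Fact quot_mulA : associative quot_mul.
Proof.
elim/quot_ind=> x; elim/quot_ind=> y; elim/quot_ind=> z.
by rewrite !quot_mulE; apply/quot_classP/pr_mulA.
Qed.

Fact quot_mulC : commutative quot_mul.
Proof.
elim/quot_ind=> x; elim/quot_ind=> y.
by rewrite !quot_mulE; apply/quot_classP/pr_mulC.
Qed.

Fact quot_mul1 : left_id (quot_class (pr_one P)) quot_mul.
Proof.
by elim/quot_ind=> x; rewrite !quot_mulE; apply/quot_classP/pr_mul1.
Qed.

Fact quot_mulD : left_distributive quot_mul (@GRing.add quot_ring).
Proof.
elim/quot_ind=> x; elim/quot_ind=> y; elim/quot_ind=> z.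
by rewrite /GRing.add /= !(quot_addE, quot_mulE); apply/quot_classP/pr_mulD.
Qed.

HB.instance Definition _ :=
  GRing.Zmodule_isComPzRing.Build quot_ring
    quot_mulA quot_mulC quot_mul1 quot_mulD.

Lemma quot_class0 : quot_class (pr_zero P) = 0. Proof. by []. Qed.
Lemma quot_class1 : quot_class (pr_one P) = 1. Proof. by []. Qed.
Lemma quot_classN x : quot_class (pr_opp x) = - quot_class x.
Proof. by rewrite -quot_oppE. Qed.
Lemma quot_classD x y : quot_class (pr_add x y) = quot_class x + quot_class y.
Proof. by rewrite -quot_addE. Qed.
Lemma quot_classM x y : quot_class (pr_mul x y) = quot_class x * quot_class y.
Proof. by rewrite -quot_mulE. Qed.

End QuotRing.

Definition prod_ring (I : Type) (R : I -> comPzRingType) : Type :=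
  forall i, R i.

Section ProdRing.
Variables (I : Type) (R : I -> comPzRingType).
Local Notation T := (prod_ring R).

HB.instance Definition _ := gen_eqMixin T.
HB.instance Definition _ := gen_choiceMixin T.

Definition prod_opp (f : T) : T := fun i => - f i.
Definition prod_add (f g : T) : T := fun i => f i + g i.
Definition prod_mul (f g : T) : T := fun i => f i * g i.

Fact prod_addA : associative prod_add.
Proof. by move=> f g h; apply/functional_extensionality_dep => i; rewrite /prod_add addrA. Qed.
Fact prod_addC : commutative prod_add.
Proof. by move=> f g; apply/functional_extensionality_dep => i; rewrite /prod_add addrC. Qed.
Fact prod_add0 : left_id (fun i => 0 : R i) prod_add.
Proof. by move=> f; apply/functional_extensionality_dep => i; rewrite /prod_add add0r. Qed.
Fact prod_addN : left_inverse (fun i => 0 : R i) prod_opp prod_add.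
Proof.
by move=> f; apply/functional_extensionality_dep => i; rewrite /prod_add /prod_opp addNr.
Qed.

HB.instance Definition _ :=
  GRing.isZmodule.Build T prod_addA prod_addC prod_add0 prod_addN.

Fact prod_mulA : associative prod_mul.
Proof. by move=> f g h; apply/functional_extensionality_dep => i; rewrite /prod_mul mulrA. Qed.
Fact prod_mulC : commutative prod_mul.
Proof. by move=> f g; apply/functional_extensionality_dep => i; rewrite /prod_mul mulrC. Qed.
Fact prod_mul1 : left_id (fun i => 1 : R i) prod_mul.
Proof. by move=> f; apply/functional_extensionality_dep => i; rewrite /prod_mul mul1r. Qed.
Fact prod_mulD : left_distributive prod_mul (@GRing.add T).
Proof.
by move=> f g h; apply/functional_extensionality_dep => i; rewrite /GRing.add /= /prod_add /prod_mul mulrDl.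
Qed.

HB.instance Definition _ :=
  GRing.Zmodule_isComPzRing.Build T prod_mulA prod_mulC prod_mul1 prod_mulD.

End ProdRing.

Section Ideals.
Variable R : comPzRingType.

Definition ideal (J : set R) : Prop :=
  [/\ J 0, forall x y, J x -> J y -> J (x + y) & forall a x, J x -> J (a * x)].

Definition prime_ideal (J : set R) : Prop :=
  [/\ ideal J, ~ J 1 & forall x y, J (x * y) -> J x \/ J y].

Definition maximal_ideal (M : set R) : Prop :=
  [/\ ideal M, ~ M 1 &
      forall J : set R, ideal J -> ~ J 1 -> M `<=` J -> J = M].

Definition local_ring : Prop := exists! M : set R, maximal_ideal M.

End Ideals.

Record spectrum (R : comPzRingType) := Prime {
  prime_set :> R -> Prop;
  primeP : prime_ideal prime_set }.

Section Localization.
Variables (R : comPzRingType) (p : spectrum R).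

Lemma prime_compl1 : ~ p 1.
Proof. by case: (primeP p). Qed.

Lemma prime_complM x y : ~ p x -> ~ p y -> ~ p (x * y).
Proof. by case: (primeP p) => _ _ pM nx ny /pM []. Qed.

Record fraction := Fraction { num : R; den : R; denP : ~ p den }.
Arguments denP : clear implicits.

Definition frac_eqv (x y : fraction) : Prop :=
  exists2 u : R, ~ p u & u * (num x * den y - num y * den x) = 0.

Definition frac_zero := Fraction 0 prime_compl1.
Definition frac_one := Fraction 1 prime_compl1.
Definition frac_opp x := Fraction (- num x) (denP x).
Definition frac_add x y :=
  Fraction (num x * den y + num y * den x) (prime_complM (denP x) (denP y)).
Definition frac_mul x y :=
  Fraction (num x * num y) (prime_complM (denP x) (denP y)).

Lemma frac_eqv1 x y : num x * den y = num y * den x -> frac_eqv x y.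
Proof. by move=> xy; exists 1; [exact: prime_compl1|rewrite xy subrr mulr0]. Qed.

Fact frac_sym x y : frac_eqv x y -> frac_eqv y x.
Proof.
by case=> u nu uxy; exists u => //; rewrite -opprB mulrN uxy oppr0.
Qed.

Fact frac_trans x y z : frac_eqv x y -> frac_eqv y z -> frac_eqv x z.
Proof.
case=> u nu uxy [v nv vyz]; exists (u * v * den y).
  by apply: prime_complM (denP y); apply: prime_complM.
have -> : u * v * den y * (num x * den z - num z * den x) =
  v * den z * (u * (num x * den y - num y * den x)) +
  u * den x * (v * (num y * den z - num z * den y)) by ring.
by rewrite uxy vyz !mulr0 addr0.
Qed.

Fact frac_opp_eqv x x' : frac_eqv x x' -> frac_eqv (frac_opp x) (frac_opp x').
Proof.
case=> u nu ux; exists u => //=.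
by rewrite !mulNr -opprD mulrN ux oppr0.
Qed.

Fact frac_add_eqv x x' y y' : frac_eqv x x' -> frac_eqv y y' ->
  frac_eqv (frac_add x y) (frac_add x' y').
Proof.
case=> u nu ux [v nv vy]; exists (u * v); first exact: prime_complM.
have -> : u * v * (num (frac_add x y) * den (frac_add x' y') -
                   num (frac_add x' y') * den (frac_add x y)) =
  v * den y * den y' * (u * (num x * den x' - num x' * den x)) +
  u * den x * den x' * (v * (num y * den y' - num y' * den y)).
  by rewrite /=; ring.
by rewrite ux vy !mulr0 addr0.
Qed.

Fact frac_mul_eqv x x' y y' : frac_eqv x x' -> frac_eqv y y' ->
  frac_eqv (frac_mul x y) (frac_mul x' y').
Proof.
case=> u nu ux [v nv vy]; exists (u * v); first exact: prime_complM.
have -> : u * v * (num (frac_mul x y) * den (frac_mul x' y') -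
                   num (frac_mul x' y') * den (frac_mul x y)) =
  v * num y * den y' * (u * (num x * den x' - num x' * den x)) +
  u * num x' * den x * (v * (num y * den y' - num y' * den y)).
  by rewrite /=; ring.
by rewrite ux vy !mulr0 addr0.
Qed.

Definition frac_prering : prering.
Proof.
refine (@PreRing fraction frac_eqv frac_zero frac_one frac_opp frac_add
  frac_mul _ frac_sym frac_trans frac_opp_eqv frac_add_eqv frac_mul_eqv
  _ _ _ _ _ _ _ _); by [] || (move=> *; apply: frac_eqv1; rewrite /=; ring).
Defined.

Definition localization := quot_ring frac_prering.

HB.instance Definition _ := GRing.ComPzRing.on localization.

Definition mkfrac (a f : R) (nf : ~ p f) : localization :=
  quot_class (Fraction a nf : frac_prering).

Lemma mkfrac_eq a f a' f' (nf : ~ p f) (nf' : ~ p f') :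
  a * f' = a' * f -> mkfrac a nf = mkfrac a' nf'.
Proof. by move=> e; apply/quot_classP/frac_eqv1. Qed.

Lemma mkfrac1 (n1 : ~ p 1) : mkfrac 1 n1 = 1.
Proof. by rewrite -quot_class1; exact: mkfrac_eq. Qed.

Lemma mkfracM a f b g (nf : ~ p f) (ng : ~ p g) (nfg : ~ p (f * g)) :
  mkfrac a nf * mkfrac b ng = mkfrac (a * b) nfg.
Proof. by rewrite -quot_classM; exact: mkfrac_eq. Qed.

Lemma mkfracB a f b g (nf : ~ p f) (ng : ~ p g) (nfg : ~ p (f * g)) :
  mkfrac a nf - mkfrac b ng = mkfrac (a * g - b * f) nfg.
Proof.
by rewrite -quot_classN -quot_classD; apply: mkfrac_eq; rewrite /= mulNr.
Qed.

End Localization.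

Section SpectrumTopology.
Variable R : comPzRingType.

HB.instance Definition _ := gen_eqMixin (spectrum R).
HB.instance Definition _ := gen_choiceMixin (spectrum R).

Definition zariski_closed (E : set R) : set (spectrum R) :=
  [set p : spectrum R | forall x, E x -> p x].

Definition spec_open (U : set (spectrum R)) : Prop :=
  exists E : set R, U = ~` zariski_closed E.

Fact spec_openT : spec_open setT.
Proof.
exists setT; apply/esym/seteqP; split=> // p _ pT.
by case: (primeP p) => _ p1 _; apply/p1/pT.
Qed.

Fact spec_openI : setI_closed spec_open.
Proof.
move=> _ _ [E ->] [E' ->].
exists [set z | exists x y, [/\ E x, E' y & z = x * y]].
rewrite -setCU; congr (~` _); apply/seteqP; split=> p /=.
  case: (primeP p) => -[p0 pD pMl] _ pM [pE|pE'] _ [x [y [Ex E'y ->]]].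
    by rewrite mulrC; apply/pMl/pE.
  by apply/pMl/pE'.
case: (primeP p) => _ _ pM pEE'; apply: contrapT => /not_orP[].
move=> /existsNP[x /not_implyP[Ex npx]] /existsNP[y /not_implyP[E'y npy]].
by have /pM[] : p (x * y) by apply: pEE'; exists x, y.
Qed.

Fact spec_open_bigU (I : Type) (f : I -> set (spectrum R)) :
  (forall i, spec_open (f i)) -> spec_open (\bigcup_i f i).
Proof.
move=> /choice[E fE]; exists (\bigcup_i E i).
apply/seteqP; split=> p /=.
  by case=> i _; rewrite fE => npE pE; apply: npE => x Ex; apply: pE; exists i.
move=> npE; apply: contrapT => nf; apply: npE => x [i _ Ex].
apply: contrapT => npx; apply: nf; exists i => //; rewrite fE => pE.
exact/npx/pE.
Qed.

HB.instance Definition _ := isOpenTopological.Build (spectrum R)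
  spec_openT spec_openI spec_open_bigU.

End SpectrumTopology.

Record opens (X : topologicalType) := Open {
  open_set :> X -> Prop;
  openP : open (open_set : set X) }.

Definition opensT (X : topologicalType) : opens X := Open (@openT X).

Definition opensI (X : topologicalType) (U V : opens X) : opens X :=
  Open (openI (openP U) (openP V)).

Lemma opensIl (X : topologicalType) (U V : opens X) :
  (opensI U V : set X) `<=` U.
Proof. by move=> x []. Qed.

Lemma opensIr (X : topologicalType) (U V : opens X) :
  (opensI U V : set X) `<=` V.
Proof. by move=> x []. Qed.

Definition opens_preim (X Y : topologicalType) (f : X -> Y)
    (f_cont : continuous f) (V : opens Y) : opens X :=
  Open ((continuousP f).1 f_cont V (openP V)).

Record presheaf (X : topologicalType) := Presheaf {
  sections :> opens X -> comPzRingType;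
  restr : forall U V : opens X,
    (V : set X) `<=` U -> {rmorphism sections U -> sections V};
  restr_id : forall (U : opens X) (UU : (U : set X) `<=` U) s,
    restr UU s = s;
  restr_comp : forall (U V W : opens X) (VU : (V : set X) `<=` U)
      (WV : (W : set X) `<=` V) (WU : (W : set X) `<=` U) s,
    restr WV (restr VU s) = restr WU s }.

(* The empty open set is left out of the sheaf axiom (and of the notion of
   isomorphism below): a sheaf of rings has the zero ring of sections over it,
   whereas the structure presheaf of a subspace of the Zariski-Riemann space
   has the whole field there, by convention. *)
Definition is_sheaf (X : topologicalType) (O : presheaf X) : Prop :=
  forall (U : opens X) (I : Type) (W : I -> opens X)
    (WU : forall i, (W i : set X) `<=` U),
    (U : set X) !=set0 -> (forall i, (W i : set X) !=set0) ->
    (U : set X) `<=` \bigcup_i (W i : set X) ->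
  forall s : forall i, O (W i),
    (forall i j, (opensI (W i) (W j) : set X) !=set0 ->
       restr O (@opensIl _ (W i) (W j)) (s i) =
       restr O (@opensIr _ (W i) (W j)) (s j)) ->
  exists! t : O U, forall i, restr O (WU i) t = s i.

Section Stalk.
Variables (X : topologicalType) (O : presheaf X) (x : X).

Record germ_rep := GermRep {
  germ_dom : opens X; germ_domP : germ_dom x; germ_val : O germ_dom }.
Arguments germ_domP : clear implicits.

Definition germ_eqv (s t : germ_rep) : Prop :=
  exists (W : opens X) (Ws : (W : set X) `<=` germ_dom s)
    (Wt : (W : set X) `<=` germ_dom t),
  W x /\ restr O Ws (germ_val s) = restr O Wt (germ_val t).

Definition germ_zero := @GermRep (opensT X) I 0.
Definition germ_one := @GermRep (opensT X) I 1.
Definition germ_opp s := GermRep (germ_domP s) (- germ_val s).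

Definition germ_op2 (op : forall R : comPzRingType, R -> R -> R)
    (s t : germ_rep) : germ_rep :=
  @GermRep (opensI (germ_dom s) (germ_dom t))
    (conj (germ_domP s) (germ_domP t))
    (op _ (restr O (@opensIl _ (germ_dom s) (germ_dom t)) (germ_val s))
          (restr O (@opensIr _ (germ_dom s) (germ_dom t)) (germ_val t))).

Definition germ_add := germ_op2 (fun R => @GRing.add R).
Definition germ_mul := germ_op2 (fun R => @GRing.mul R).

Fact germ_refl s : germ_eqv s s.
Proof. by exists (germ_dom s), (fun y h => h), (fun y h => h); split=> //; exact: germ_domP. Qed.

Fact germ_sym s t : germ_eqv s t -> germ_eqv t s.
Proof. by move=> [W [Ws [Wt [Wx e]]]]; exists W, Wt, Ws. Qed.

Fact germ_trans s t u : germ_eqv s t -> germ_eqv t u -> germ_eqv s u.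
Proof.
move=> [W [Ws [Wt [Wx st]]]] [W' [W't [W'u [W'x tu]]]].
have IW : (opensI W W' : set X) `<=` W by move=> y [].
have IW' : (opensI W W' : set X) `<=` W' by move=> y [].
exists (opensI W W'), (subset_trans IW Ws), (subset_trans IW' W'u); split=> //.
rewrite -(restr_comp Ws IW) st (restr_comp _ _ (subset_trans IW' W't)).
by rewrite -(restr_comp W't IW') tu (restr_comp _ _ (subset_trans IW' W'u)).
Qed.

Fact germ_opp_eqv s s' : germ_eqv s s' -> germ_eqv (germ_opp s) (germ_opp s').
Proof.
by move=> [W [Ws [Ws' [Wx e]]]]; exists W, Ws, Ws'; rewrite !rmorphN e.
Qed.

Fact germ_add_eqv s s' t t' : germ_eqv s s' -> germ_eqv t t' ->
  germ_eqv (germ_add s t) (germ_add s' t').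
Proof.
move=> [W [Ws [Ws' [Wx ss]]]] [W' [W't [W't' [W'x tt]]]].
have IW : (opensI W W' : set X) `<=` W by move=> y [].
have IW' : (opensI W W' : set X) `<=` W' by move=> y [].
exists (opensI W W'), (setISS Ws W't), (setISS Ws' W't'); split=> //=.
rewrite !rmorphD; congr (_ + _).
  rewrite !(restr_comp _ _ (subset_trans IW Ws)) -(restr_comp Ws IW) ss.
  by rewrite !(restr_comp _ _ (subset_trans IW Ws')).
rewrite !(restr_comp _ _ (subset_trans IW' W't)) -(restr_comp W't IW') tt.
by rewrite !(restr_comp _ _ (subset_trans IW' W't')).
Qed.

Fact germ_mul_eqv s s' t t' : germ_eqv s s' -> germ_eqv t t' ->
  germ_eqv (germ_mul s t) (germ_mul s' t').
Proof.
move=> [W [Ws [Ws' [Wx ss]]]] [W' [W't [W't' [W'x tt]]]].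
have IW : (opensI W W' : set X) `<=` W by move=> y [].
have IW' : (opensI W W' : set X) `<=` W' by move=> y [].
exists (opensI W W'), (setISS Ws W't), (setISS Ws' W't'); split=> //=.
rewrite !rmorphM; congr (_ * _).
  rewrite !(restr_comp _ _ (subset_trans IW Ws)) -(restr_comp Ws IW) ss.
  by rewrite !(restr_comp _ _ (subset_trans IW Ws')).
rewrite !(restr_comp _ _ (subset_trans IW' W't)) -(restr_comp W't IW') tt.
by rewrite !(restr_comp _ _ (subset_trans IW' W't')).
Qed.

Fact restr_comp_trans (U V W : opens X) (VU : (V : set X) `<=` U)
    (WV : (W : set X) `<=` V) (s : O U) :
  restr O WV (restr O VU s) = restr O (subset_trans WV VU) s.
Proof. exact: restr_comp. Qed.

Fact restr_irr (U V : opens X) (VU VU' : (V : set X) `<=` U) (s : O U) :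
  restr O VU s = restr O VU' s.
Proof. by rewrite (Prop_irrelevance VU VU'). Qed.

Fact germ_addA s t u :
  germ_eqv (germ_add s (germ_add t u)) (germ_add (germ_add s t) u).
Proof.
exists (opensI (germ_dom s) (opensI (germ_dom t) (germ_dom u))).
exists (fun y h => h), (fun y '(conj a (conj b c)) => conj (conj a b) c).
split; first by split; [|split]; exact: germ_domP.
rewrite /= !rmorphD addrA !restr_comp_trans.
by congr (_ + _ + _); exact: restr_irr.
Qed.

Fact germ_mulA s t u :
  germ_eqv (germ_mul s (germ_mul t u)) (germ_mul (germ_mul s t) u).
Proof.
exists (opensI (germ_dom s) (opensI (germ_dom t) (germ_dom u))).
exists (fun y h => h), (fun y '(conj a (conj b c)) => conj (conj a b) c).
split; first by split; [|split]; exact: germ_domP.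
rewrite /= !rmorphM mulrA !restr_comp_trans.
by congr (_ * _ * _); exact: restr_irr.
Qed.

Fact germ_addC s t : germ_eqv (germ_add s t) (germ_add t s).
Proof.
exists (opensI (germ_dom s) (germ_dom t)).
exists (fun y h => h), (fun y '(conj a b) => conj b a).
split; first by split; exact: germ_domP.
rewrite /= !rmorphD addrC !restr_comp_trans.
by congr (_ + _); exact: restr_irr.
Qed.

Fact germ_mulC s t : germ_eqv (germ_mul s t) (germ_mul t s).
Proof.
exists (opensI (germ_dom s) (germ_dom t)).
exists (fun y h => h), (fun y '(conj a b) => conj b a).
split; first by split; exact: germ_domP.
rewrite /= !rmorphM mulrC !restr_comp_trans.
by congr (_ * _); exact: restr_irr.
Qed.

Fact germ_add0 s : germ_eqv (germ_add germ_zero s) s.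
Proof.
exists (germ_dom s), (fun y h => conj I h), (fun y h => h).
split; first exact: germ_domP.
rewrite /= !rmorphD !rmorph0 add0r restr_comp_trans.
exact: restr_irr.
Qed.

Fact germ_mul1 s : germ_eqv (germ_mul germ_one s) s.
Proof.
exists (germ_dom s), (fun y h => conj I h), (fun y h => h).
split; first exact: germ_domP.
rewrite /= !rmorphM !rmorph1 mul1r restr_comp_trans.
exact: restr_irr.
Qed.

Fact germ_addN s : germ_eqv (germ_add (germ_opp s) s) germ_zero.
Proof.
exists (germ_dom s), (fun y h => conj h h), (fun y h => I).
split; first exact: germ_domP.
rewrite /= !rmorphD !rmorphN rmorph0 !restr_comp_trans; apply/eqP.
rewrite addrC subr_eq0; apply/eqP.
exact: restr_irr.
Qed.

Fact germ_mulD s t u : germ_eqv (germ_mul (germ_add s t) u)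
  (germ_add (germ_mul s u) (germ_mul t u)).
Proof.
exists (opensI (germ_dom s) (opensI (germ_dom t) (germ_dom u))).
exists (fun y '(conj a (conj b c)) => conj (conj a b) c).
exists (fun y '(conj a (conj b c)) => conj (conj a c) (conj b c)).
split; first by split; [|split]; exact: germ_domP.
rewrite /= !(rmorphM, rmorphD) mulrDl !restr_comp_trans.
by congr (_ * _ + _ * _); exact: restr_irr.
Qed.

Definition germ_prering : prering :=
  PreRing germ_refl germ_sym germ_trans germ_opp_eqv
    germ_add_eqv germ_mul_eqv germ_addA germ_addC germ_add0 germ_addN
    germ_mulA germ_mulC germ_mul1 germ_mulD.

Definition stalk := quot_ring germ_prering.

HB.instance Definition _ := GRing.ComPzRing.on stalk.

End Stalk.

Definition locally_ringed (X : topologicalType) (O : presheaf X) : Prop :=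
  is_sheaf O /\ forall x : X, local_ring (stalk O x).

(* An isomorphism of ringed spaces induces ring isomorphisms on stalks, so
   between locally ringed spaces it is automatically local. *)
Record ringed_iso (X Y : topologicalType) (OX : presheaf X) (OY : presheaf Y) :=
  RingedIso {
  iso_map : X -> Y;
  iso_inv : Y -> X;
  iso_mapK : cancel iso_map iso_inv;
  iso_invK : cancel iso_inv iso_map;
  iso_map_continuous : continuous iso_map;
  iso_inv_continuous : continuous iso_inv;
  iso_sharp : forall V : opens Y, (V : set Y) !=set0 ->
    {rmorphism OY V -> OX (opens_preim iso_map_continuous V)};
  iso_sharp_bij : forall V V0, bijective (@iso_sharp V V0);
  iso_sharp_restr : forall (V W : opens Y) V0 W0 (WV : (W : set Y) `<=` V)
    (fWV : (opens_preim iso_map_continuous W : set X) `<=`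
             opens_preim iso_map_continuous V) s,
    @iso_sharp W W0 (restr OY WV s) = restr OX fWV (@iso_sharp V V0 s) }.

Section SpecSheaf.
Variable R : comPzRingType.

Definition local_product (U : opens (spectrum R)) : comPzRingType :=
  prod_ring (fun p : set_type (U : set (spectrum R)) => localization (val p)).

Definition locally_fraction (U : opens (spectrum R)) (s : local_product U) :
    Prop :=
  forall p : set_type (U : set (spectrum R)),
    exists (W : opens (spectrum R)) (a f : R), W (val p) /\
      (forall q : set_type (U : set (spectrum R)), W (val q) ->
        exists nf : ~ (val q) f, s q = mkfrac a nf).

Fact locally_fraction_subring (U : opens (spectrum R)) :
  subring_closed [in (locally_fraction (U := U) : set (local_product U))].
Proof.
apply: subring_closedP.
- move=> p; exists U, 1, 1; split; first exact: set_mem (valP p).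
  by move=> q _; exists (@prime_compl1 _ (val q)); rewrite mkfrac1.
- move=> s t Hs Ht p.
  have [W [a [f [Wp sE]]]] := Hs p; have [W' [b [g [W'p tE]]]] := Ht p.
  exists (opensI W W'), (a * g - b * f), (f * g); split=> // q [Wq W'q].
  have [nf sq] := sE q Wq; have [ng tq] := tE q W'q.
  exists (prime_complM nf ng); rewrite -(mkfracB a b nf ng) -sq -tq //.
- move=> s t Hs Ht p.
  have [W [a [f [Wp sE]]]] := Hs p; have [W' [b [g [W'p tE]]]] := Ht p.
  exists (opensI W W'), (a * b), (f * g); split=> // q [Wq W'q].
  have [nf sq] := sE q Wq; have [ng tq] := tE q W'q.
  exists (prime_complM nf ng); rewrite -(mkfracM a b nf ng) -sq -tq //.
Qed.

Definition spec_sections (U : opens (spectrum R)) : subring (local_product U) :=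
  Subring (@locally_fraction_subring U).

Section Restriction.
Variables (U V : opens (spectrum R)).
Hypothesis VU : (V : set (spectrum R)) `<=` U.

Definition incl_point (p : set_type (V : set (spectrum R))) :
    set_type (U : set (spectrum R)) :=
  exist _ (val p) (mem_set (VU (set_mem (valP p)))).

Fact spec_restr_subproof (s : spec_sections U) :
  spec_sections V (fun p => val s (incl_point p) : localization (val p)).
Proof.
move=> p; have [W [a [f [Wp sE]]]] := subring_typeP s (incl_point p).
by exists W, a, f; split=> // q Wq; exact: sE (incl_point q) Wq.
Qed.

Definition spec_restr (s : spec_sections U) : spec_sections V :=
  subring_elt (spec_restr_subproof s).

Fact spec_restr_is_zmod_morphism : zmod_morphism spec_restr.
Proof. by move=> s t; exact: val_inj. Qed.

Fact spec_restr_is_monoid_morphism : monoid_morphism spec_restr.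
Proof. by split=> [|s t]; exact: val_inj. Qed.

HB.instance Definition _ := GRing.isZmodMorphism.Build
  (spec_sections U) (spec_sections V) spec_restr spec_restr_is_zmod_morphism.
HB.instance Definition _ := GRing.isMonoidMorphism.Build
  (spec_sections U) (spec_sections V) spec_restr spec_restr_is_monoid_morphism.

End Restriction.

Fact spec_restr_id (U : opens (spectrum R))
    (UU : (U : set (spectrum R)) `<=` U) (s : spec_sections U) :
  spec_restr UU s = s.
Proof.
apply/val_inj/functional_extensionality_dep => -[p Up] /=.
by rewrite /incl_point /=; congr (val s (exist _ _ _)); exact: Prop_irrelevance.
Qed.

Fact spec_restr_comp (U V W : opens (spectrum R))
    (VU : (V : set (spectrum R)) `<=` U) (WV : (W : set (spectrum R)) `<=` V)
    (WU : (W : set (spectrum R)) `<=` U) (s : spec_sections U) :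
  spec_restr WV (spec_restr VU s) = spec_restr WU s.
Proof.
apply/val_inj/functional_extensionality_dep => -[p Wp] /=.
by rewrite /incl_point /=; congr (val s (exist _ _ _)); exact: Prop_irrelevance.
Qed.

Definition structure_sheaf : presheaf (spectrum R) :=
  @Presheaf _ (fun U => spec_sections U : comPzRingType)
    (fun U V VU => spec_restr VU : {rmorphism _ -> _})
    spec_restr_id spec_restr_comp.

End SpecSheaf.

Definition affine_scheme (X : topologicalType) (O : presheaf X) : Prop :=
  locally_ringed O /\
  exists R : comPzRingType, inhabited (ringed_iso O (structure_sheaf R)).

Section Domains.
Variable F : fieldType.
Implicit Types A V : subring F.

Definition quotient_field A : set F :=
  [set x | exists a b, [/\ A a, A b, b != 0 & x = a / b]].

Definition valuation_ring V : Prop :=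
  forall x, quotient_field V x -> x != 0 -> V x \/ V x^-1.

(* The localization of A at P, inside the quotient field of A. *)
Definition localize_set A (P : spectrum A) : set F :=
  [set x | exists a s : A, ~ P s /\ x = val a / val s].

Fact localize_subring A (P : spectrum A) : subring_closed [in localize_set P].
Proof.
have nz (s : A) : ~ P s -> val s != 0.
  apply: contra_notN => /eqP s0; have -> : s = 0 by exact: val_inj.
  by case: (primeP P) => -[].
apply: subring_closedP.
- by exists 1, 1; split; [exact: prime_compl1|rewrite divr1].
- move=> _ _ [a [s [ns ->]]] [b [t [nt ->]]].
  exists (a * t - b * s), (s * t); split; first exact: prime_complM.
  by rewrite -mulNr addf_div ?nz // mulNr rmorphB !rmorphM.
- move=> _ _ [a [s [ns ->]]] [b [t [nt ->]]].
  exists (a * b), (s * t); split; first exact: prime_complM.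
  by rewrite !rmorphM mulf_div.
Qed.

Definition localize A (P : spectrum A) : subring F :=
  Subring (localize_subring P).

Definition prufer_domain A : Prop :=
  forall P : spectrum A, valuation_ring (localize P).

End Domains.

Record zr_space (F : fieldType) (D : subring F) := ZRPoint {
  zr_ring :> subring F;
  zr_valuation : valuation_ring zr_ring;
  zr_quotient_field : quotient_field zr_ring = setT;
  zr_sub : (D : set F) `<=` zr_ring }.

Section ZariskiRiemann.
Variables (F : fieldType) (D : subring F).

HB.instance Definition _ := gen_eqMixin (zr_space D).
HB.instance Definition _ := gen_choiceMixin (zr_space D).

Definition zr_basic (S : set F) : set (zr_space D) :=
  [set V : zr_space D | S `<=` V].

Fact zr_basic_cover : \bigcup_(S in finite_set) zr_basic S = setT.
Proof. by apply/seteqP; split=> // V _; exists set0; [exact: finite_set0|]. Qed.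

Fact zr_basic_join (S T : set F) (V : zr_space D) :
  finite_set S -> finite_set T -> zr_basic S V -> zr_basic T V ->
  exists E, [/\ finite_set E, zr_basic E V &
                 zr_basic E `<=` zr_basic S `&` zr_basic T].
Proof.
move=> finS finT SV TV; exists (S `|` T); split.
- by rewrite finite_setU.
- by move=> x [/SV|/TV].
- by move=> V' STV'; split=> x Sx; apply: STV'; [left|right].
Qed.

HB.instance Definition _ :=
  isBaseTopological.Build (zr_space D) zr_basic_cover zr_basic_join.

Fact ring_bigcap_subring (Z : set (zr_space D)) :
  subring_closed [in \bigcap_(V in Z) (V : set F)].
Proof.
apply: subring_closedP.
- by move=> V _; exact: subring1.
- by move=> x y Zx Zy V ZV; apply: subringB; [exact: Zx|exact: Zy].
- by move=> x y Zx Zy V ZV; apply: subringM; [exact: Zx|exact: Zy].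
Qed.

Definition ring_bigcap (Z : set (zr_space D)) : subring F :=
  Subring (ring_bigcap_subring Z).

End ZariskiRiemann.

Definition inverse_closed (X : topologicalType) (Z : set X) : Prop :=
  Z = \bigcap_(U in [set U | [/\ open U, compact U & Z `<=` U]]) U.

Section ZariskiRiemannSheaf.
Variables (F : fieldType) (D : subring F) (Z : set (zr_space D)).

(* Over the empty open set this is the empty intersection, that is, F. *)
Definition zr_sections (U : opens (set_type Z)) : subring F :=
  ring_bigcap (val @` (U : set (set_type Z))).

Lemma zr_sectionsT : zr_sections (opensT (set_type Z)) = ring_bigcap Z :> set F.
Proof.
rewrite /=; suff -> : val @` (opensT (set_type Z) : set (set_type Z)) = Z by [].
apply/seteqP; split=> [_ [V _ <-]|V ZV]; first exact: set_mem (valP V).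
by exists (exist _ V (mem_set ZV)).
Qed.

Section Restriction.
Variables (U V : opens (set_type Z)).
Hypothesis VU : (V : set (set_type Z)) `<=` U.

Fact zr_restr_subproof (s : zr_sections U) : zr_sections V (val s).
Proof. by move=> _ [W VW <-]; apply: (subring_typeP s); exists W => //; exact: VU. Qed.

Definition zr_restr (s : zr_sections U) : zr_sections V :=
  subring_elt (zr_restr_subproof s).

Fact zr_restr_is_zmod_morphism : zmod_morphism zr_restr.
Proof. by move=> s t; exact: val_inj. Qed.

Fact zr_restr_is_monoid_morphism : monoid_morphism zr_restr.
Proof. by split=> [|s t]; exact: val_inj. Qed.

HB.instance Definition _ := GRing.isZmodMorphism.Build
  (zr_sections U) (zr_sections V) zr_restr zr_restr_is_zmod_morphism.
HB.instance Definition _ := GRing.isMonoidMorphism.Build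
  (zr_sections U) (zr_sections V) zr_restr zr_restr_is_monoid_morphism.

End Restriction.

Fact zr_restr_id (U : opens (set_type Z)) (UU : (U : set (set_type Z)) `<=` U)
    (s : zr_sections U) :
  zr_restr UU s = s.
Proof. exact: val_inj. Qed.

Fact zr_restr_comp (U V W : opens (set_type Z))
    (VU : (V : set (set_type Z)) `<=` U) (WV : (W : set (set_type Z)) `<=` V)
    (WU : (W : set (set_type Z)) `<=` U) (s : zr_sections U) :
  zr_restr WV (zr_restr VU s) = zr_restr WU s.
Proof. exact: val_inj. Qed.

Definition zr_presheaf : presheaf (set_type Z) :=
  @Presheaf _ (fun U => zr_sections U : comPzRingType)
    (fun U V VU => zr_restr VU : {rmorphism _ -> _})
    zr_restr_id zr_restr_comp.

End ZariskiRiemannSheaf.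

(* Main.v *)
From HB Require Import structures.
Require Import Defs.
From mathcomp Require Import all_boot all_algebra finmap ring.
From mathcomp Require Import boolp classical_sets cardinality topology.

(* Let A be the intersection of the rings in Z. Both directions turn on showing
   that every localization A_P belongs to Z.

   If (Z, O_Z) is isomorphic to Spec R, then taking sections identifies R with A
   inside F, and the point of Z over P, being its own stalk, is A_P. Hence A is
   Prüfer with quotient field F. A valuation ring W that contains A equals A_P for
   P its center, so it is in Z; if instead some a in A is not in W, then the basic
   open set of a separates W from Z, and it is quasicompact, since an ultrafilter
   converges to the ring of those x that lie in almost all V.

   Conversely, let A be Prüfer with quotient field F and let U be a quasicompact open
   set containing Z but not A_P. Each s outside A_P gives a, b in P with
   a + b s = 1, and a ring V containing s cannot have both a and b in its maximal
   ideal. By quasicompactness finitely many elements of P generate the unit ideal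
   in every V in Z, which is impossible in a Prüfer domain. So Z = {A_P}, and
   V |-> (center of V in A) is the required isomorphism onto Spec A. *)

Set Implicit Arguments.
Unset Strict Implicit.
Unset Printing Implicit Defensive.

Import GRing.Theory.

Local Open Scope classical_set_scope.
Local Open Scope ring_scope.

(** * Prime ideals *)

Section PrimeIdeals.
Variable R : comPzRingType.
Implicit Types J M : set R.

Lemma spectrum_eq (p q : spectrum R) : (p : set R) `<=>` q -> p = q.
Proof.
case: p q => p pP [q qP] /= pq; have {}pq : p = q by exact/seteqP.
by case: _ / pq qP => qP; congr Prime; exact: Prop_irrelevance.
Qed.

Lemma ideal_bigcup (S : set (set R)) : S !=set0 -> total_on S subset ->
  (forall J, S J -> ideal J) -> ideal (\bigcup_(J in S) J).
Proof.
move=> [J0 SJ0] totS idS; split.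
- by exists J0 => //; case: (idS _ SJ0).
- move=> x y [J SJ Jx] [K SK Ky]; have [JK|KJ] := totS _ _ SJ SK.
    by exists K => //; case: (idS _ SK) => _ KD _; apply: KD => //; exact: JK.
  by exists J => //; case: (idS _ SJ) => _ JD _; apply: JD => //; exact: KJ.
- by move=> a x [J SJ Jx]; exists J => //; case: (idS _ SJ) => _ _; apply.
Qed.

Lemma exists_maximal_above J : ideal J -> ~ J 1 ->
  exists M, [/\ ideal M, ~ M 1, J `<=` M &
    forall K, ideal K -> ~ K 1 -> M `<=` K -> K = M].
Proof.
(* Zorn's lemma also tests the empty chain, whose union is empty and so not an ideal. Hence the
   condition is put on the union of [J] and [X]. *)
move=> idJ nJ1; pose P X := ideal (J `|` X) /\ ~ (J `|` X) 1.
have [S SP totS|M [[idM nM1] Mmax]] := @Zorn_bigcup R P.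
  have [->|S0] := eqVneq S set0; first by rewrite /P bigcup_set0 setU0.
  have US : J `|` \bigcup_(X in S) X = \bigcup_(X in [set J `|` X | X in S]) X.
    apply/seteqP; split=> x.
      case=> [Jx|[X SX Xx]]; last by exists (J `|` X); [exists X|right].
      by move/set0P: S0 => [X SX]; exists (J `|` X); [exists X|left].
    by case=> _ [X SX <-] [Jx|Xx]; [left|right; exists X].
  split; last first.
    rewrite US => -[_ [X SX <-]] JX1; by case: (SP _ SX).
  rewrite US; apply: ideal_bigcup.
  - by move/set0P: S0 => [X SX]; exists (J `|` X); exists X.
  - move=> _ _ [X SX <-] [Y SY <-].
    by case: (totS _ _ SX SY) => XY; [left|right]; exact: setUS.
  - by move=> _ [X SX <-]; case: (SP _ SX).
exists (J `|` M); split=> // K idK nK1 JMK.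
have JK : J `|` K = K by apply/setUidPr => x Jx; apply: JMK; left.
apply: contrapT => neK; apply: (Mmax K); last by split; rewrite JK.
split; first by move=> x Mx; apply: JMK; right.
by move=> KM; apply: neK; apply/seteqP; split=> // x /KM; right.
Qed.

Lemma maximal_ideal_prime M : ideal M -> ~ M 1 ->
  (forall K, ideal K -> ~ K 1 -> M `<=` K -> K = M) -> prime_ideal M.
Proof.
move=> idM nM1 maxM; split=> // x y Mxy; apply: contrapT => /not_orP[nMx nMy].
have [M0 MD MM] := idM.
(* [K] is [M + Rx]. If it contains 1, multiplying by [y] puts [y] in [M]; otherwise maximality gives
   [K = M], which contains [x]. *)
pose K := [set z | exists m a, M m /\ z = m + a * x].
have idK : ideal K.
  split.
  - by exists 0, 0; split=> //; rewrite mul0r addr0.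
  - move=> _ _ [m [a [Mm ->]]] [m' [a' [Mm' ->]]].
    exists (m + m'), (a + a'); split; first exact: MD.
    by ring.
  - move=> b _ [m [a [Mm ->]]]; exists (b * m), (b * a).
    by split; [exact: MM|ring].
have MK : M `<=` K by move=> m Mm; exists m, 0; rewrite mul0r addr0.
have Kx : K x by exists 0, 1; rewrite mul1r add0r.
have [[m [a [Mm ea]]]|nK1] := pselect (K 1).
  apply: nMy; rewrite -(mul1r y) ea mulrDl.
  by apply: MD; [rewrite mulrC; exact: MM|rewrite -mulrA; exact: MM].
by apply: nMx; rewrite -(maxM K idK nK1 MK).
Qed.

Lemma exists_prime_above J : ideal J -> ~ J 1 ->
  exists p : spectrum R, J `<=` p.
Proof.
move=> idJ nJ1; have [M [idM nM1 JM Mmax]] := exists_maximal_above idJ nJ1.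
by exists (Prime (maximal_ideal_prime idM nM1 Mmax)).
Qed.

(** A local-to-global principle: applied to an ideal of admissible denominators, it replaces
    denominators found prime by prime with the denominator 1. *)
Lemma ideal_in_no_prime J : ideal J ->
  (forall p : spectrum R, exists2 x, J x & ~ p x) -> J 1.
Proof.
move=> idJ Jp; apply: contrapT => /(exists_prime_above idJ)[p Jsub].
by have [x Jx] := Jp p; apply; exact: Jsub.
Qed.

(** An ideal with an element outside [M] contains a unit, so [M] contains every proper ideal. *)
Lemma local_ring_nonunits M : ideal M -> ~ M 1 ->
  (forall x, ~ M x -> exists y, y * x = 1) -> local_ring R.
Proof.
move=> idM nM1 unitM.
have sub K : ideal K -> ~ K 1 -> K `<=` M.
  move=> [_ _ KM] nK1 x Kx; apply: contrapT => /unitM[y yx].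
  by apply: nK1; rewrite -yx; exact: KM.
exists M; split.
  split=> // K idK nK1 MK; apply/seteqP; split=> //; exact: sub.
by move=> K [idK nK1 maxK]; rewrite (maxK M) //; exact: sub.
Qed.

End PrimeIdeals.

(** * Valuation rings and the Zariski-Riemann space *)

Section SubringTheory.
Variables (F : fieldType) (A : subring F).

Lemma subring0 : A 0.
Proof. by rewrite -(subrr 1); apply: subringB; exact: subring1. Qed.

Lemma subringN x : A x -> A (- x).
Proof. by move=> Ax; rewrite -sub0r; apply: subringB => //; exact: subring0. Qed.

Lemma subringD x y : A x -> A y -> A (x + y).
Proof. by move=> Ax Ay; rewrite -(opprK y); apply: subringB => //; exact: subringN. Qed.

Lemma spectrum0 (P : spectrum A) : P 0.
Proof. by case: (Defs.primeP P) => -[]. Qed.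

Lemma spectrumM (P : spectrum A) a x : P x -> P (a * x).
Proof. by case: (Defs.primeP P) => -[_ _ PM] _ _; exact: PM. Qed.

Lemma spectrum_compl_neq0 (P : spectrum A) (s : A) : ~ P s -> val s != 0.
Proof.
apply: contra_notN => /eqP s0; have -> : s = 0 by exact: val_inj.
exact: spectrum0.
Qed.

Lemma subring_localize (P : spectrum A) : (A : set F) `<=` localize P.
Proof.
move=> x Ax; exists (subring_elt Ax), 1; split; first exact: prime_compl1.
by rewrite divr1.
Qed.

Lemma localizeV (P : spectrum A) (s : A) : ~ P s -> localize P (val s)^-1.
Proof. by move=> ns; exists 1, s; rewrite div1r. Qed.

(** From [1 / s = a / t] follows [t = a s], so [s] in [P] would put [t] in [P]. The case [s = 0]
    must be excluded because [0^-1 = 0] lies in the localization. *)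
Lemma localize_unit (P : spectrum A) (s : A) :
  localize P (val s)^-1 -> val s != 0 -> ~ P s.
Proof.
move=> [a [t [nt e]]] s0 Ps; apply: (nt).
suff -> : t = a * s by exact: spectrumM.
apply: val_inj; rewrite rmorphM /=.
by rewrite -[LHS](mulfVK s0) e mulrCA divff ?mulr1 // (spectrum_compl_neq0 nt).
Qed.

End SubringTheory.

Section ZariskiRiemannPoints.
Variables (F : fieldType) (D : subring F).
Implicit Types V W : zr_space D.

Lemma zr_total V x : V x \/ V x^-1.
Proof.
have [->|x0] := eqVneq x 0; first by left; exact: subring0.
by apply: zr_valuation => //; rewrite zr_quotient_field.
Qed.

Lemma zr_eq V W : (V : set F) = W -> V = W.
Proof.
case: V W => [[v vP] vV vQ vD] [[w wP] wV wQ wD] /= vw.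
case: _ / vw in wP wV wQ wD *; case: _ / (Prop_irrelevance vP wP) in wV wQ wD *.
by congr ZRPoint; exact: Prop_irrelevance.
Qed.

(** Totality also forces the quotient field to be [F]: each [x] is [x / 1] or [1 / x^-1]. *)
Lemma zr_of_total (A : subring F) : (D : set F) `<=` A ->
  (forall x, A x \/ A x^-1) -> exists V, (V : set F) = A.
Proof.
move=> DA totA.
have valA : valuation_ring A by move=> x _ _; exact: totA.
have quotA : quotient_field A = setT.
  apply/seteqP; split=> // x _; have [->|x0] := eqVneq x 0.
    exists 0, 1; rewrite oner_neq0 mul0r.
    by split=> //; [exact: subring0|exact: subring1].
  have [Ax|Ax] := totA x.
    by exists x, 1; rewrite oner_neq0 divr1; split=> //; exact: subring1.
  by exists 1, x^-1; rewrite invr_eq0 invrK mul1r; split=> //; exact: subring1.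
by exists (ZRPoint valA quotA DA).
Qed.

(* The clause [x = 0] is needed since [0^-1 = 0]. *)
Definition zr_max V : set F := [set x | x = 0 \/ ~ V x^-1].

Lemma zr_maxPn V x : ~ zr_max V x <-> x != 0 /\ V x^-1.
Proof.
split=> [/not_orP[/eqP x0 /contrapT]|[/eqP x0 Vx] []] //.
Qed.

Lemma zr_max1 V : ~ zr_max V 1.
Proof. by apply/zr_maxPn; rewrite oner_neq0 invr1; split=> //; exact: subring1. Qed.

Lemma zr_maxM V a x : V a -> zr_max V x -> zr_max V (a * x).
Proof.
move=> Va mx; apply: contrapT => /zr_maxPn[].
rewrite mulf_eq0 negb_or => /andP[a0 x0]; rewrite invfM => Vax.
move: mx; apply/zr_maxPn; split=> //.
by rewrite -(mulVKf a0 x^-1); exact: subringM.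
Qed.

Lemma zr_maxD V x y : zr_max V x -> zr_max V y -> zr_max V (x + y).
Proof.
(* One of [x / y] and [y / x] is in [V]; by symmetry, and for [y] nonzero, [x + y] is then a
   [V]-multiple of [y]. *)
wlog Vxy : x y / V (x / y).
  move=> H mx my; case: (zr_total V (x / y)) => [|]; first by move/H; apply.
  by rewrite invf_div => /H; rewrite addrC; apply.
move=> mx my; have [y0|y0] := eqVneq y 0; first by rewrite y0 addr0.
have -> : x + y = (x / y + 1) * y by rewrite mulrDl mulfVK // mul1r.
by apply: zr_maxM => //; apply: subringD => //; exact: subring1.
Qed.

Lemma zr_max_prime V x y : zr_max V (x * y) -> zr_max V x \/ zr_max V y.
Proof.
move=> mxy; apply: contrapT => /not_orP[/zr_maxPn[x0 Vx] /zr_maxPn[y0 Vy]].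
move: mxy; apply/zr_maxPn; rewrite mulf_neq0 // invfM; split=> //.
exact: subringM.
Qed.

Lemma center_prime (A : subring F) V (AV : (A : set F) `<=` V) :
  prime_ideal [set a : A | zr_max V (val a)].
Proof.
split=> [|/zr_max1//|x y /=]; last exact: zr_max_prime.
split=> [|x y /= |a x /=]; [by left|exact: zr_maxD|].
by apply: zr_maxM; exact/AV/subring_typeP.
Qed.

Definition center (A : subring F) V (AV : (A : set F) `<=` V) : spectrum A :=
  Prime (center_prime AV).

Lemma localize_center_sub (A : subring F) V (AV : (A : set F) `<=` V) :
  (localize (center AV) : set F) `<=` V.
Proof.
move=> _ [a [s [/zr_maxPn[s0 Vs] ->]]].
by apply: subringM => //; exact/AV/subring_typeP.
Qed.

(** If a nonzero [x] in [V] has [x^-1 = a / s] with [s] off the center, then [a] is off the center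
    too, since otherwise [s = x a] would be in the maximal ideal of [V]. Hence [x = s / a] is in the
    localization. *)
Lemma localize_center (A : subring F) V (AV : (A : set F) `<=` V) :
  (forall x, localize (center AV) x \/ localize (center AV) x^-1) ->
  (localize (center AV) : set F) = V.
Proof.
move=> tot; apply/seteqP; split; first exact: localize_center_sub.
move=> x Vx; have [//|[a [s [ns e]]]] := tot x.
have [x0|x0] := eqVneq x 0; first by rewrite x0; exact: subring0.
exists s, a; split; last by rewrite -invf_div -e invrK.
move=> ma; apply: ns.
have s0 : val s != 0.
  apply: contra_neq x0 => s0; move: e; rewrite s0 invr0 mulr0.
  by move/eqP; rewrite invr_eq0 => /eqP.
suff: zr_max V (val s) by [].
have -> : val s = x * val a.
  by rewrite -(mulfVK s0 (val a)) -e mulVKf.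
exact: zr_maxM.
Qed.

Lemma center_localize (A : subring F) (P : spectrum A) V :
  (V : set F) = localize P -> forall AV : (A : set F) `<=` V, center AV = P.
Proof.
move=> VP AV; apply: spectrum_eq; split=> s /=.
  move=> ms; apply: contrapT => ns; move: ms; apply/zr_maxPn.
  by rewrite (spectrum_compl_neq0 ns) VP; split=> //; exact: localizeV.
move=> Ps; apply: contrapT => /zr_maxPn[s0]; rewrite VP => Vs.
exact: (localize_unit Vs s0).
Qed.

End ZariskiRiemannPoints.

(** * Open sets of the Zariski-Riemann space and quasicompactness of the basic ones *)

Section ZariskiRiemannTopology.
Variables (F : fieldType) (D : subring F).
Local Notation X := (zr_space D).

Lemma open_zr_basic (S : set F) : finite_set S -> open (zr_basic (D := D) S).
Proof.
move=> finS; exists [set S]; first by move=> _ ->.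
by rewrite bigcup_set1.
Qed.

Lemma open_zr_elt (x : F) : open [set V : X | V x].
Proof.
rewrite (_ : mkset _ = zr_basic (D := D) [set x]).
  exact/open_zr_basic/finite_set1.
by apply/seteqP; split=> [V Vx _ ->//|V]; exact.
Qed.

Lemma zr_openP (U : set X) : open U <-> forall V, U V ->
  exists S, [/\ finite_set S, zr_basic S V & zr_basic S `<=` U].
Proof.
split=> [[E finE <-] V [S ES SV]|HU].
  by exists S; split=> //; [exact: finE|move=> W SW; exists S].
rewrite (_ : U = \bigcup_(S in [set S | finite_set S /\ zr_basic S `<=` U])
  zr_basic S).
  by apply: bigcup_open => S [finS _]; exact: open_zr_basic.
apply/seteqP; split=> [V /HU[S [? ? ?]]|V [S [_ SU]]]; first by exists S.
exact: SU.
Qed.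

(** Basic conditions only ask that certain elements belong to the ring, so they survive enlarging
    it. *)
Lemma zr_open_overring (U : set X) (V W : X) :
  open U -> (V : set F) `<=` W -> U V -> U W.
Proof.
move=> /zr_openP oU VW /oU[S [_ SV]]; apply; exact: subset_trans VW.
Qed.

Lemma compact_zr_basic (S : set F) : compact (zr_basic (D := D) S).
Proof.
rewrite compact_ultra => G UG GS; pose L := [set x : F | G [set V : X | V x]].
have LE x : L x -> G [set V : X | V x] by [].
have subL : subring_closed [in L].
  apply: subring_closedP; rewrite /L /=.
  - by apply: filterS GS => V _; exact: subring1.
  - by move=> x y /LE Gx /LE Gy; apply: filterS2 Gx Gy => V; exact: subringB.
  - by move=> x y /LE Gx /LE Gy; apply: filterS2 Gx Gy => V; exact: subringM.
have [|x|V VL] := @zr_of_total F D (Subring subL).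
- by move=> x Dx; apply: filterS GS => V _; exact: zr_sub.
(* An ultrafilter contains a given set or its complement, and a valuation ring missing [x] contains
   [x^-1]; so [L] inherits totality. *)
- have [Gx|Gx] := in_ultra_setVsetC [set V : X | V x] UG; first by left.
  by right; apply: filterS Gx => V nVx; case: (zr_total V x).
exists V; split.
  move=> x Sx; rewrite VL; apply: filterS GS => W; exact.
move=> U /=; rewrite nbhsE => -[O [/zr_openP oO /oO[T [finT TV TO]]] OU].
apply: filterS OU _; apply: filterS TO _.
(* As [T] is finite, the basic neighborhood of [V] is a finite intersection of sets that belong to
   [G] one element at a time. *)
have [T' eT] := finite_fsetP.1 finT.
have -> : zr_basic (D := D) T = \bigcap_(x in [set` T']) [set V : X | V x].
  by rewrite eT; apply/seteqP; split.
apply: filter_bigI => x xT'; suff: V x by rewrite VL.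
by apply: TV; rewrite eT.
Qed.

End ZariskiRiemannTopology.

(** * Prüfer domains *)

Section Prufer.
Variables (F : fieldType) (A : subring F).
Hypothesis pruferA : prufer_domain A.
Hypothesis quotA : quotient_field A = setT.
Implicit Types P : spectrum A.

(** The predicate [valuation_ring] tests only elements of the ring's own quotient field; for a
    localization of [A] this is all of [F] by [quotA]. *)
Lemma prufer_total P x : localize P x \/ localize P x^-1.
Proof.
have [->|x0] := eqVneq x 0; first by left; exact: subring0.
apply: pruferA => //.
have [a [b [Aa Ab b0 ->]]] : quotient_field A x by rewrite quotA.
by exists a, b; split=> //; exact: subring_localize.
Qed.

(* The ideal (A : s) generates the unit ideal together with its multiple by
   [s], because this holds in every valuation ring [A_P]. *)
Lemma prufer_denominators (s : F) : exists a b : A,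
  [/\ A (val a * s), A (val b * s) & val a + val b * s = 1].
Proof.
pose K := [set k : A | exists a b : A,
  [/\ A (val a * s), A (val b * s) & val k = val a + val b * s]].
suff [a [b [? ? e]]] : K 1 by exists a, b; split=> //; rewrite -e rmorph1.
apply: ideal_in_no_prime.
  split.
  - by exists 0, 0; rewrite !rmorph0 mul0r addr0; split=> //; exact: subring0.
  - move=> k k' /= [a [b [Aa Ab e]]] [a' [b' [Aa' Ab' e']]].
    exists (a + a'), (b + b'); rewrite !rmorphD !mulrDl; split.
    + exact: subringD.
    + exact: subringD.
    + by rewrite /= e e' addrACA.
  - move=> c k /= [a [b [Aa Ab e]]]; exists (c * a), (c * b).
    rewrite !rmorphM -!mulrA; have Ac := subring_typeP c; split.
    + exact: subringM.
    + exact: subringM.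
    + by rewrite /= e mulrDr.
move=> P; have [s0|s0] := eqVneq s 0.
  exists 1; last exact: prime_compl1.
  by exists 1, 0; rewrite s0 !mulr0 addr0; split=> //; exact: subring0.
(* If [s = c / t], write [t = t + 0 s], where [t s = c]; if [s^-1 = c / t], write [t = 0 + c s]. *)
have [[c [t [nt e]]]|[c [t [nt e]]]] := prufer_total P s; exists t => //.
  have t0 := spectrum_compl_neq0 nt.
  exists t, 0; rewrite rmorph0 mul0r addr0; split=> //; last exact: subring0.
  by rewrite e mulrCA divff // mulr1; exact: subring_typeP.
have t0 := spectrum_compl_neq0 nt.
have cs : val c * s = val t.
  by rewrite -(mulfVK t0 (val c)) -e mulrAC mulVf // mul1r.
exists 0, c; rewrite rmorph0 mul0r add0r cs; split=> //; first exact: subring0.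
exact: subring_typeP.
Qed.

Lemma localize_common_den P (l : seq F) :
  (forall d, d \in l -> localize P d) ->
  exists2 t : A, ~ P t & forall d, d \in l -> A (val t * d).
Proof.
elim: l => [_|x l IHl Hl]; first by exists 1 => //; exact: prime_compl1.
have [d dl|t nt tl] := IHl; first by apply: Hl; rewrite in_cons dl orbT.
have [a [u [nu ex]]] := Hl x (mem_head _ _).
exists (u * t) => [|d]; first exact: prime_complM.
rewrite in_cons rmorphM => /orP[/eqP->|/tl At]; last first.
  by rewrite -mulrA; apply: subringM => //; exact: subring_typeP.
have -> : val u * val t * x = val a * val t.
  by rewrite ex mulrAC mulrCA divff ?mulr1 // (spectrum_compl_neq0 nu).
by apply: subringM; exact: subring_typeP.
Qed.

(** Over the valuation ring [localize P], a finitely generated fractional ideal is generated by one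
    of its generators: compare each new element with the generator chosen so far. *)
Lemma prufer_dominant P (l : seq F) : (exists2 d, d \in l & d != 0) ->
  exists2 c, c \in l & c != 0 /\ forall d, d \in l -> localize P (d / c).
Proof.
elim: l => [[]//|x l IHl] [d + d0].
have xx y : y != 0 -> localize P (y / y).
  by move=> y0; rewrite divff //; exact: subring1.
have [lnz _|] := pselect (exists2 d, d \in l & d != 0).
  have [c cl [c0 Hc]] := IHl lnz.
  have [Px|Px] := prufer_total P (x / c).
    exists c; first by rewrite in_cons cl orbT.
    by split=> // y; rewrite in_cons => /orP[/eqP->//|/Hc].
  have [x0|x0] := eqVneq x 0.
    exists c; first by rewrite in_cons cl orbT.
    split=> // y; rewrite in_cons => /orP[/eqP->|/Hc//].
    by rewrite x0 mul0r; exact: subring0.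
  exists x; first exact: mem_head.
  split=> // y; rewrite in_cons => /orP[/eqP->|/Hc Py]; first exact: xx.
  have -> : y / x = y / c * (c / x) by rewrite mulrA mulfVK.
  by rewrite -(invf_div x c); exact: subringM.
move=> nl dl; have {dl} xd : d = x.
  by move: dl; rewrite in_cons => /orP[/eqP//|dl]; case: nl; exists d.
exists x; first exact: mem_head.
rewrite -xd; split=> // y; rewrite in_cons => /orP[/eqP->|yl].
  exact: xx.
have [->|y0] := eqVneq y 0; first by rewrite mul0r; exact: subring0.
by case: nl; exists y.
Qed.

End Prufer.

(** * Localizations of a Prüfer intersection lie in an inverse closed [Z] *)

Section PruferIntersection.
Variables (F : fieldType) (D : subring F) (Z : set (zr_space D)).
Variable A : subring F.
Hypothesis AZ : (A : set F) = \bigcap_(V in Z) (V : set F).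
Hypothesis Z0 : Z !=set0.
Hypothesis pruferA : prufer_domain A.
Hypothesis quotA : quotient_field A = setT.

Lemma subring_bigcap_sub V : Z V -> (A : set F) `<=` V.
Proof. by move=> ZV; rewrite AZ => x; exact. Qed.

(* Otherwise [l] generates the unit ideal in each [V], so [t / c] is in [A] for
   [c] a generator of [l A_P] and [t] outside [P] a common denominator of
   [l / c]; then [t = c (t / c)] is in [P]. *)
Lemma prime_seq_center (P : spectrum A) (l : seq F) :
  (forall d, d \in l -> exists2 a : A, P a & val a = d) ->
  exists2 V, Z V & forall d, d \in l -> zr_max V d.
Proof.
move=> lP; apply: contrapT => nV.
have unitV V : Z V -> exists2 d, d \in l & d != 0 /\ V d^-1.
  move=> ZV; apply: contrapT => nd; apply: nV; exists V => // d dl.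
  by apply: contrapT => /zr_maxPn ?; apply: nd; exists d.
have [|c cl [c0 Hc]] := prufer_dominant pruferA quotA P (l := l).
  by have [V /unitV[d dl [d0 _]]] := Z0; exists d.
have [|t nt Ht] := @localize_common_den _ A P [seq d / c | d <- l].
  by move=> _ /mapP[d dl ->]; exact: Hc.
have Atc : A (val t / c).
  suff : (A : set F) (val t / c) by [].
  rewrite AZ => V ZV; have [d dl [d0 Vd]] := unitV V ZV.
  have -> : val t / c = val t * (d / c) * d^-1.
    by rewrite -!mulrA; congr (_ * _); rewrite mulrCA divff // mulr1.
  by apply: subringM => //; apply: (subring_bigcap_sub ZV); apply/Ht/map_f.
have [a Pa ac] := lP c cl; apply: nt.
suff -> : t = subring_elt Atc * a by exact: spectrumM.
by apply: val_inj; rewrite rmorphM /= ac mulfVK.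
Qed.

Lemma localize_in_inverse_closed (P : spectrum A) : inverse_closed Z ->
  exists2 V, Z V & (V : set F) = localize P.
Proof.
move=> invZ; have [W WP] : exists W : zr_space D, (W : set F) = localize P.
  apply: zr_of_total; last exact: prufer_total.
  apply: subset_trans (@subring_localize _ _ P).
  by rewrite AZ => x Dx V _; exact: zr_sub.
exists W => //; rewrite invZ => U [oU coU ZU]; apply: contrapT => nUW.
(* Quasicompactness is used in its near-covering form: the finite lists of elements of [P], directed
   by inclusion, generate a filter, so lists found near each ring of [U] yield a single list that
   works on all of [U]. *)
pose lP (l : seq F) := forall d, d \in l -> exists2 a : A, P a & val a = d.
pose supseq (l : seq F) := [set l' : seq F | lP l' /\ {subset l <= l'}].
have filP : Filter (filter_from lP supseq).
  apply: filter_from_filter; first by exists [::].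
  move=> l l' Pl Pl'; exists (l ++ l').
    by move=> d; rewrite mem_cat => /orP[/Pl|/Pl'].
  by move=> k [Pk sk]; split; split=> // d dl; apply: sk; rewrite mem_cat dl ?orbT.
have [|l Pl Hl] := (compact_near_coveringP U).1 coU _ _
    (fun (l : seq F) (V : zr_space D) => Z V -> exists2 d, d \in l & ~ zr_max V d) filP.
  move=> W' UW'; have [S [finS SW' SU]] := (zr_openP U).1 oU W' UW'.
  have [s Ss nWs] : exists2 s, S s & ~ W s.
    apply: contrapT => nS; apply/nUW/SU => x Sx.
    by apply: contrapT => ?; apply: nS; exists x.
  have [a [b [Aa Ab ab1]]] := prufer_denominators pruferA quotA s.
  (* If [c] were outside [P], then [s = (c s) / c] would lie in [localize P], that is, in [W]. *)
  have Pden (c : A) : A (val c * s) -> P c.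
    move=> Acs; apply: contrapT => nc; apply: nWs; rewrite WP.
    exists (subring_elt Acs), c; split=> //=.
    by rewrite mulrAC divff ?mul1r // (spectrum_compl_neq0 nc).
  exists (zr_basic S, supseq [:: val a; val b]).
    split; first by apply: open_nbhs_nbhs; split=> //; exact: open_zr_basic.
    exists [:: val a; val b] => // d.
    by rewrite !inE => /orP[] /eqP ->; [exists a|exists b] => //; exact: Pden.
  move=> [V l] [/= SV [_ abl]] ZV; apply: contrapT => nd.
  apply: (@zr_max1 _ _ V).
  have mV (c : F) : c \in [:: val a; val b] -> zr_max V c.
    by move=> /abl cl; apply: contrapT => ?; apply: nd; exists c.
  rewrite -ab1; apply: zr_maxD; first by apply: mV; rewrite mem_head.
  rewrite mulrC; apply: zr_maxM; first exact: SV.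
  by apply: mV; rewrite !inE eqxx orbT.
have [V ZV Vl] := prime_seq_center Pl.
have [||d dl] := Hl l _ V _ ZV; [by split|exact: ZU|].
by apply; exact: Vl.
Qed.

End PruferIntersection.

(** * The sheaf of a subspace *)

Section ZariskiRiemannStalks.
Variables (F : fieldType) (D : subring F) (Z : set (zr_space D)).

Lemma open_set_typeP (O : set (set_type Z)) : open O <->
  exists2 U : set (zr_space D), open U & O = [set V | U (val V)].
Proof. by split=> -[U oU UO]; exists U. Qed.

Lemma open_elt (x : F) : open [set V : set_type Z | (val V : set F) x].
Proof. by apply/open_set_typeP; exists [set V | V x] => //; exact: open_zr_elt. Qed.

Definition elt_opens (x : F) : opens (set_type Z) := Open (open_elt x).

Lemma set_type_open_overring (O : opens (set_type Z)) (V W : set_type Z) :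
  (val V : set F) `<=` val W -> O V -> O W.
Proof.
move=> VW; have [U oU OU] := (open_set_typeP O).1 (openP O).
have OE x : O x = U (val x) by rewrite -[O x]/((O : set _) x) OU.
by rewrite !OE; exact: zr_open_overring.
Qed.

Lemma zr_section_sub (U : opens (set_type Z)) (s : zr_sections U) V :
  U V -> (val V : zr_space D) (val s).
Proof. by move=> UV; apply: (subring_typeP s); exists V. Qed.

Variable V : set_type Z.
Notation stk := (stalk (zr_presheaf Z) V).
Notation germ := (germ_rep (zr_presheaf Z) V).

Definition germ_value (g : germ) : F := val (germ_val g : zr_sections _).

(** Restriction does not change the element of [F], so germs with the same value agree on the
    intersection of their domains. *)
Lemma germ_value_eqv (g h : germ) : germ_eqv g h <-> germ_value g = germ_value h.
Proof.
split=> [[W [Wg [Wh [WV e]]]]|e]; first exact: (congr1 (@sval _ _) e).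
exists (opensI (germ_dom g) (germ_dom h)), (@opensIl _ _ _), (@opensIr _ _ _).
by split; [split; exact: germ_domP|exact: val_inj].
Qed.

(** This map identifies the stalk with the ring [V] itself: it is injective, with image [V]. *)
Definition stalk_value (x : stk) : F := germ_value (repr x).

Lemma stalk_value_class (g : germ_prering (zr_presheaf Z) V) :
  stalk_value (quot_class g) = germ_value g.
Proof. by apply/germ_value_eqv; exact: (repr_quot_class g). Qed.

Lemma stalk_value_inj : injective stalk_value.
Proof.
elim/quot_ind=> g; elim/quot_ind=> h.
by rewrite !stalk_value_class => e; apply/quot_classP/germ_value_eqv.
Qed.

Lemma stalk_value0 : stalk_value 0 = 0.
Proof. by rewrite -quot_class0 stalk_value_class. Qed.

Lemma stalk_value1 : stalk_value 1 = 1.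
Proof. by rewrite -quot_class1 stalk_value_class. Qed.

Lemma stalk_valueD : {morph stalk_value : x y / x + y}.
Proof.
by elim/quot_ind=> g; elim/quot_ind=> h; rewrite -quot_classD !stalk_value_class.
Qed.

Lemma stalk_valueM : {morph stalk_value : x y / x * y}.
Proof.
by elim/quot_ind=> g; elim/quot_ind=> h; rewrite -quot_classM !stalk_value_class.
Qed.

Lemma stalk_value_sub (x : stk) : (val V : zr_space D) (stalk_value x).
Proof. exact/zr_section_sub/germ_domP. Qed.

Lemma stalk_value_surj (x : F) : (val V : zr_space D) x ->
  exists y, stalk_value y = x.
Proof.
move=> Vx; have Ux : zr_sections (elt_opens x) x by move=> _ [W Wx <-].
exists (quot_class (@GermRep _ (zr_presheaf Z) V (elt_opens x) Vx
  (subring_elt Ux) : germ_prering _ _)).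
by rewrite stalk_value_class.
Qed.

Lemma zr_stalk_local : local_ring stk.
Proof.
apply: (@local_ring_nonunits _ [set x | zr_max (val V : zr_space D) (stalk_value x)]).
- split=> [|x y|a x] /=; first by rewrite stalk_value0; left.
    by rewrite stalk_valueD; exact: zr_maxD.
  by rewrite stalk_valueM; apply: zr_maxM; exact: stalk_value_sub.
- by rewrite /= stalk_value1; exact: zr_max1.
- move=> x /zr_maxPn[x0 /stalk_value_surj[y yx]]; exists y.
  by apply: stalk_value_inj; rewrite stalk_valueM yx stalk_value1 mulVf.
Qed.

End ZariskiRiemannStalks.

(** * The sheaf axiom when [F] is a point of [Z] *)

Section ZariskiRiemannSheafAxiom.
Variables (F : fieldType) (D : subring F) (Z : set (zr_space D)).
Variable G : set_type Z.
Hypothesis GT : (val G : zr_space D) = setT :> set F.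

Lemma zr_open_generic (U : opens (set_type Z)) :
  (U : set (set_type Z)) !=set0 -> U G.
Proof. by case=> V; apply: set_type_open_overring; rewrite GT. Qed.

(** Any two nonempty open sets meet at the generic point [G], so compatible local sections are one
    and the same element of [F], which is the glued section. *)
Lemma zr_is_sheaf : is_sheaf (zr_presheaf Z).
Proof.
move=> U I W WU U0 W0 UW s sE.
have valE i j : val (s i : zr_sections _) = val (s j : zr_sections _).
  have WG : (opensI (W i) (W j) : set (set_type Z)) !=set0.
    by exists G; split; exact: zr_open_generic.
  exact: (congr1 (@sval _ _) (sE i j WG)).
have [i0 _ _] := UW G (zr_open_generic U0).
have Us : zr_sections U (val (s i0 : zr_sections _)).
  move=> _ [V UV <-]; have [i _ WV] := UW _ UV.
  by rewrite (valE i0 i); exact: zr_section_sub.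
exists (subring_elt Us); split=> [i|t tE].
  by apply: val_inj => /=; exact: valE.
apply: val_inj => /=; exact/esym/(congr1 (@sval _ _) (tE i0)).
Qed.

End ZariskiRiemannSheafAxiom.

(** * The isomorphism with the spectrum *)

Section SpectrumOpens.
Variable R : comPzRingType.

Definition spec_basic (f : R) : set (spectrum R) := [set p | ~ p f].

Lemma open_spec_basic f : open (spec_basic f).
Proof.
exists [set f]; apply/seteqP; split=> p /=; first by move=> npf pE; exact/npf/pE.
by move=> nE pf; apply: nE => _ ->.
Qed.

Lemma spec_openP (O : set (spectrum R)) :
  (forall p, O p -> exists2 f, ~ p f & spec_basic f `<=` O) -> open O.
Proof.
move=> HO; exists [set f | spec_basic f `<=` O]; apply/seteqP; split=> p.
  by move=> /HO[f npf fO] pE; apply: npf; exact: pE.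
move=> /= npE; apply: contrapT => nOp; apply: npE => f fO.
by apply: contrapT => npf; apply/nOp/fO.
Qed.

(** Stability under generization is what places the zero ideal of a domain in every nonempty open
    set. *)
Lemma spec_open_sub (O : set (spectrum R)) (p q : spectrum R) :
  open O -> (q : set R) `<=` p -> O p -> O q.
Proof.
by move=> [E ->] qp npE qE; apply: npE => x /qE; exact: qp.
Qed.

Definition spec_point (U : opens (spectrum R)) p (Up : U p) :
    set_type (U : set (spectrum R)) := exist _ p (mem_set Up).

End SpectrumOpens.

Section LocalizationValue.
Variables (F : fieldType) (A : subring F) (p : spectrum A).

Definition frac_value (x : fraction p) : F := val (num x) / val (den x).

Lemma frac_value_eqv (x y : fraction p) :
  frac_eqv x y <-> frac_value x = frac_value y.
Proof.
have nx := spectrum_compl_neq0 (@denP _ _ x).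
have ny := spectrum_compl_neq0 (@denP _ _ y).
rewrite /frac_value; split=> [[u nu /(congr1 val)]|/eqP].
  rewrite rmorphM rmorphB !rmorphM rmorph0 => /eqP.
  rewrite mulf_eq0 (negbTE (spectrum_compl_neq0 nu)) subr_eq0 /= => e.
  by apply/eqP; rewrite eqr_div.
by rewrite eqr_div // => /eqP e; apply: frac_eqv1; apply: val_inj; rewrite !rmorphM.
Qed.

(** Compares the localization built as a quotient of fractions with its copy [localize p] inside
    [F]. *)
Definition loc_value (x : localization p) : F := frac_value (repr x).

Lemma loc_value_class (x : frac_prering p) :
  loc_value (quot_class x) = frac_value x.
Proof. by apply/frac_value_eqv; exact: (repr_quot_class x). Qed.

Lemma loc_value_mkfrac a f (nf : ~ p f) :
  loc_value (mkfrac a nf) = val a / val f.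
Proof. exact: loc_value_class. Qed.

Lemma loc_value_inj : injective loc_value.
Proof.
elim/quot_ind=> x; elim/quot_ind=> y.
by rewrite !loc_value_class => e; apply/quot_classP/frac_value_eqv.
Qed.

Lemma loc_value1 : loc_value 1 = 1.
Proof. by rewrite -quot_class1 loc_value_class /frac_value /= divr1. Qed.

Lemma loc_valueB : {morph loc_value : x y / x - y}.
Proof.
elim/quot_ind=> x; elim/quot_ind=> y.
rewrite -quot_classN -quot_classD !loc_value_class /frac_value /=.
have nx := spectrum_compl_neq0 (@denP _ _ x).
have ny := spectrum_compl_neq0 (@denP _ _ y).
by rewrite -mulNr addf_div // rmorphD !rmorphM rmorphN.
Qed.

Lemma loc_valueM : {morph loc_value : x y / x * y}.
Proof.
elim/quot_ind=> x; elim/quot_ind=> y.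
by rewrite -quot_classM !loc_value_class /frac_value /= mulf_div.
Qed.

Lemma loc_value_localize (x : localization p) : localize p (loc_value x).
Proof.
by elim/quot_ind: x => -[a f nf]; rewrite loc_value_class; exists a, f.
Qed.

End LocalizationValue.

Section SectionValue.
Variables (F : fieldType) (A : subring F).
Notation Spec := (spectrum A).

Lemma zero_ideal_prime : prime_ideal [set a : A | a = 0].
Proof.
split=> [||x y /= /(congr1 val)/eqP].
- split=> //= [x y -> ->|a x ->]; [exact: addr0|exact: mulr0].
- by move=> /= /(congr1 val)/eqP; rewrite rmorph1 rmorph0 oner_eq0.
- rewrite rmorphM rmorph0 mulf_eq0 => /orP[]/eqP e; [left|right]; exact: val_inj.
Qed.

Definition zero_ideal : Spec := Prime zero_ideal_prime.

(* The zero ideal is in every nonempty open set, so the values of a section at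
   all points are read off from the same fraction there. *)
Lemma section_value_const (V : opens Spec) (s : spec_sections V)
    (p q : set_type (V : set Spec)) :
  loc_value (val s p) = loc_value (val s q).
Proof.
pose eta := zero_ideal.
have eta_open (O : opens Spec) r : O r -> O eta.
  move=> Or; apply: spec_open_sub (openP O) _ Or => _ /= ->; exact: spectrum0.
have Veta : V eta by apply: (eta_open V (val p)); exact: set_mem (valP p).
suff H r : loc_value (val s r) = loc_value (val s (spec_point Veta)) by rewrite !H.
have [W [a [f [Wr sE]]]] := subring_typeP s r.
have [nf ->] := sE r Wr; have [nf' ->] := sE (spec_point Veta) (eta_open W _ Wr).
by rewrite !loc_value_mkfrac.
Qed.

End SectionValue.

(** * The center map as an isomorphism onto the spectrum of [A] *)

Section PruferAffine.
Variables (F : fieldType) (D : subring F) (Z : set (zr_space D)).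
Variable A : subring F.
Hypothesis AZ : (A : set F) = \bigcap_(V in Z) (V : set F).
Hypothesis totA : forall (P : spectrum A) x, localize P x \/ localize P x^-1.
Hypothesis locZ : forall P : spectrum A, exists2 V, Z V & (V : set F) = localize P.

Let AV (V : set_type Z) : (A : set F) `<=` (val V : zr_space D).
Proof. by apply: (subring_bigcap_sub AZ); exact: set_mem (valP V). Qed.

Definition center_map (V : set_type Z) : spectrum A := center (AV V).

Definition localize_map (P : spectrum A) : set_type Z :=
  let: exist2 V ZV _ := cid2 (locZ P) in exist _ V (mem_set ZV).

Lemma localize_mapE P : (val (localize_map P) : zr_space D) = localize P :> set F.
Proof. by rewrite /localize_map; case: cid2. Qed.

Lemma center_mapE V : localize (center_map V) = (val V : zr_space D) :> set F.
Proof. by apply: localize_center => x; exact: totA. Qed.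

Lemma center_mapK : cancel center_map localize_map.
Proof.
move=> V; apply: val_inj; apply: zr_eq.
by rewrite localize_mapE center_mapE.
Qed.

Lemma localize_mapK : cancel localize_map center_map.
Proof. by move=> P; apply: center_localize; exact: localize_mapE. Qed.

Lemma center_map_continuous : continuous center_map.
Proof.
apply/continuousP => _ [E ->].
(* An element [e] is off the center of [V] exactly when it is a unit of [V]. The clause [val e != 0]
   matters since [0^-1 = 0] lies in every [V]. *)
rewrite (_ : _ @^-1` _ = \bigcup_(e in E)
    [set V : set_type Z | val e != 0 /\ (val V : zr_space D) (val e)^-1]).
  apply: bigcup_open => e _; have [e0|e0] := eqVneq (val e) 0.
    by rewrite (_ : mkset _ = set0); [exact: open0|apply/seteqP; split=> // V []].
  rewrite (_ : mkset _ = [set V | (val V : zr_space D) (val e)^-1]).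
    exact: open_elt.
  by apply/seteqP; split=> V; [case|split].
apply/seteqP; split=> V /=.
  move=> /existsNP[e /not_implyP[Ee /zr_maxPn ?]]; by exists e.
by move=> [e Ee /zr_maxPn nVe] VE; exact/nVe/VE.
Qed.

Lemma localize_map_continuous : continuous localize_map.
Proof.
apply/continuousP => O /open_set_typeP[U oU ->]; apply: spec_openP => P /= UP.
have [S [/finite_seqP[l ->] lP lU]] := (zr_openP U).1 oU _ UP.
(* With [t] a common denominator of [l], every prime avoiding [t] has a localization containing
   [l]. *)
have [|t nt tl] := @localize_common_den _ _ P l.
  by move=> d dl; have := lP d dl; rewrite localize_mapE.
exists t => // Q nQt /=; apply: lU => d dl; rewrite localize_mapE.
exists (subring_elt (tl d dl)), t; split=> //=.
by rewrite mulrAC divff ?mul1r // (spectrum_compl_neq0 nt).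
Qed.

Section Sharp.
Variables (U : opens (spectrum A)) (p : set_type (U : set (spectrum A))).

(** For [V] over [U], read the value of [s] at the center of [V] instead of at [p]; there it lies in
    the localization, which is [V]. *)
Fact center_sharp_subproof (s : spec_sections U) :
  zr_sections (opens_preim center_map_continuous U) (loc_value (val s p)).
Proof.
move=> _ [V UV <-]; rewrite -center_mapE.
rewrite (section_value_const s p (spec_point UV)).
exact: loc_value_localize.
Qed.

Definition center_sharp (s : structure_sheaf A U) :
    zr_presheaf Z (opens_preim center_map_continuous U) :=
  subring_elt (center_sharp_subproof s).

Fact center_sharp_is_zmod_morphism : zmod_morphism center_sharp.
Proof. by move=> s t; apply: val_inj => /=; rewrite -loc_valueB. Qed.

Fact center_sharp_is_monoid_morphism : monoid_morphism center_sharp.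
Proof.
split=> [|s t]; apply: val_inj => /=; first by rewrite -(loc_value1 (val p)).
by rewrite -loc_valueM.
Qed.

HB.instance Definition _ := GRing.isZmodMorphism.Build
  _ _ center_sharp center_sharp_is_zmod_morphism.
HB.instance Definition _ := GRing.isMonoidMorphism.Build
  _ _ center_sharp center_sharp_is_monoid_morphism.

Lemma center_sharp_inj : injective center_sharp.
Proof.
move=> s t /(congr1 val) /= st; apply: val_inj.
apply: functional_extensionality_dep => q; apply: loc_value_inj.
by rewrite (section_value_const s q p) st (section_value_const t p q).
Qed.

Lemma center_sharp_surj x : exists s, center_sharp s = x.
Proof.
have xloc (q : set_type (U : set (spectrum A))) :
    exists r : localization (val q), loc_value r = val x.
  have : localize (val q) (val x).
    rewrite -localize_mapE; apply: zr_section_sub.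
    by rewrite /= localize_mapK; exact: set_mem (valP q).
  by case=> a [f [nf ->]]; exists (mkfrac a nf); exact: loc_value_mkfrac.
pose s q := sval (cid (xloc q)).
have sE q : loc_value (s q) = val x by rewrite /s; case: cid.
have sfrac : spec_sections U s.
  (* A fraction [a / f] for [x] at [q] represents [x] at every prime avoiding [f], because
     localizations embed in [F]. *)
  move=> q; have := loc_value_localize (s q); rewrite sE => -[a [f [nf e]]].
  exists (Open (open_spec_basic f)), a, f; split=> // r nfr; exists nfr.
  by apply: loc_value_inj; rewrite sE loc_value_mkfrac.
by exists (subring_elt sfrac); apply: val_inj; exact: sE.
Qed.

Lemma center_sharp_bij : bijective center_sharp.
Proof.
have [g gK] := choice center_sharp_surj.
by exists g => // s; apply: center_sharp_inj.
Qed.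

End Sharp.

Lemma zr_affine : affine_scheme (zr_presheaf Z).
Proof.
(* Localizing at the zero ideal gives [F], the generic point that the sheaf axiom uses. *)
have [G GT] : exists G : set_type Z, (val G : zr_space D) = setT :> set F.
  have [V ZV VE] := locZ (zero_ideal A).
  exists (exist _ V (mem_set ZV)); rewrite /= VE; apply/seteqP; split=> // x _.
  have [//|[a [t [nt e]]]] := totA (zero_ideal A) x.
  have [a0|a0] := pselect (a = 0); last first.
    by exists t, a; split=> //; rewrite -(invrK x) e invf_div.
  move: e; rewrite a0 rmorph0 mul0r => /eqP; rewrite invr_eq0 => /eqP ->.
  exact: subring0.
split; first by split; [exact: (zr_is_sheaf GT)|exact: zr_stalk_local].
exists A; split.
(* Sections are read off at a chosen point of each nonempty open set; by [section_value_const] the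
   choice does not affect the value. *)
have pt (U : opens (spectrum A)) : (U : set (spectrum A)) !=set0 ->
    set_type (U : set (spectrum A)).
  by move=> /cid[p Up]; exact: spec_point Up.
apply: (@RingedIso _ _ _ _ center_map localize_map center_mapK localize_mapK
  center_map_continuous localize_map_continuous
  (fun U U0 => center_sharp (pt U U0) : {rmorphism _ -> _})).
- by move=> U U0; exact: center_sharp_bij.
- move=> U W U0 W0 WU fWU s; apply: val_inj => /=.
  exact: (section_value_const (s : spec_sections U)
            (incl_point WU (pt W W0)) (pt U U0)).
Qed.

End PruferAffine.

(** * Recovering the localizations from an isomorphism *)

Section AffineLocalization.
Variables (F : fieldType) (D : subring F) (Z : set (zr_space D)).
Hypothesis Z0 : Z !=set0.
Variables (R : comPzRingType)
  (phi : ringed_iso (zr_presheaf Z) (structure_sheaf R)).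
Variable A : subring F.
Hypothesis AZ : (A : set F) = \bigcap_(V in Z) (V : set F).

Implicit Types U W : opens (spectrum R).

Let iso_cont : continuous (iso_map phi) := @iso_map_continuous _ _ _ _ phi.
Let iso_inv_cont : continuous (iso_inv phi) := @iso_inv_continuous _ _ _ _ phi.

Definition iso_value U (U0 : (U : set (spectrum R)) !=set0)
    (s : spec_sections U) : F :=
  val (iso_sharp phi U0 s : zr_sections _).

Section IsoValue.
Variables (U : opens (spectrum R)) (U0 : (U : set (spectrum R)) !=set0).

Lemma iso_valueM (s t : spec_sections U) :
  iso_value U0 (s * t) = iso_value U0 s * iso_value U0 t.
Proof. by rewrite /iso_value rmorphM. Qed.

Lemma iso_valueD (s t : spec_sections U) :
  iso_value U0 (s + t) = iso_value U0 s + iso_value U0 t.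
Proof. by rewrite /iso_value rmorphD. Qed.

Lemma iso_value1 : iso_value U0 1 = 1.
Proof. by rewrite /iso_value rmorph1. Qed.

Lemma iso_value_sub (s : spec_sections U) (V : set_type Z) :
  U (iso_map phi V) -> (val V : zr_space D) (iso_value U0 s).
Proof.
rewrite /iso_value => UV.
exact: (@zr_section_sub _ _ _ (opens_preim iso_cont U)).
Qed.

Lemma iso_value_surj (x : F) :
  (forall V : set_type Z, U (iso_map phi V) -> (val V : zr_space D) x) ->
  exists s, iso_value U0 s = x.
Proof.
move=> Ux; have Ax : zr_sections (opens_preim iso_cont U) x.
  by move=> _ [V UV <-]; exact: Ux.
have [g _ gK] := iso_sharp_bij phi U0.
by exists (g (subring_elt Ax)); rewrite /iso_value gK.
Qed.

Lemma iso_value_restr W (W0 : (W : set (spectrum R)) !=set0)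
    (WU : (W : set (spectrum R)) `<=` U) (s : spec_sections U) :
  iso_value W0 (spec_restr WU s) = iso_value U0 s.
Proof.
have WU' : (opens_preim iso_cont W : set (set_type Z)) `<=`
    opens_preim iso_cont U by move=> V; exact: WU.
by have /(congr1 (@sval _ _)) := @iso_sharp_restr _ _ _ _ phi U W U0 W0 WU WU' s.
Qed.

End IsoValue.

Fact spec_const_subproof U (r : R) :
  spec_sections U (fun p => mkfrac r (@prime_compl1 _ (val p))).
Proof.
move=> p; exists U, r, 1; split; first exact: set_mem (valP p).
by move=> q _; exists (@prime_compl1 _ (val q)).
Qed.

Definition spec_const U (r : R) : spec_sections U :=
  subring_elt (@spec_const_subproof U r).

Lemma spec_constM U r t : spec_const U (r * t) = spec_const U r * spec_const U t.
Proof.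
apply: val_inj; apply: functional_extensionality_dep => p /=.
have n11 := prime_complM (@prime_compl1 _ (val p)) (@prime_compl1 _ (val p)).
by rewrite [RHS](mkfracM _ _ _ _ n11); apply: mkfrac_eq; ring.
Qed.

Lemma spec_constD U r t : spec_const U (r + t) = spec_const U r + spec_const U t.
Proof.
apply: val_inj; apply: functional_extensionality_dep => p /=.
rewrite -[RHS]quot_classD; apply: mkfrac_eq => /=; ring.
Qed.

Lemma spec_const1 U : spec_const U 1 = 1.
Proof.
apply: val_inj; apply: functional_extensionality_dep => p /=.
exact: mkfrac1.
Qed.

Lemma specT0 : (opensT (spectrum R) : set (spectrum R)) !=set0.
Proof. by have [V ZV] := Z0; exists (iso_map phi (exist _ V (mem_set ZV))). Qed.

(** The ring map from [R] to the global sections over [Z], viewed in [F]; its image turns out to be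
    [A]. *)
Definition iso_const (r : R) : F := iso_value specT0 (spec_const _ r).

Lemma iso_constE U (U0 : (U : set (spectrum R)) !=set0) r :
  iso_value U0 (spec_const U r) = iso_const r.
Proof.
have UT : (U : set (spectrum R)) `<=` opensT (spectrum R) by [].
by rewrite /iso_const -(iso_value_restr specT0 U0 UT); congr iso_value; exact: val_inj.
Qed.

Lemma iso_constM r t : iso_const (r * t) = iso_const r * iso_const t.
Proof. by rewrite /iso_const spec_constM iso_valueM. Qed.

Lemma iso_constD r t : iso_const (r + t) = iso_const r + iso_const t.
Proof. by rewrite /iso_const spec_constD iso_valueD. Qed.

Lemma iso_const1 : iso_const 1 = 1.
Proof. by rewrite /iso_const spec_const1 iso_value1. Qed.

Lemma iso_const_sub r : A (iso_const r).
Proof.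
suff : (A : set F) (iso_const r) by [].
rewrite AZ => V ZV.
exact: (@iso_value_sub _ specT0 _ (exist _ V (mem_set ZV))).
Qed.

(** Near [p] the section is a fraction [a / g]. Since restriction preserves values, the local
    identity [g s = a] becomes an identity in [F]. *)
Lemma iso_value_fraction U (U0 : (U : set (spectrum R)) !=set0)
    (s : spec_sections U) (p : spectrum R) : U p ->
  exists2 g, ~ p g & exists a, iso_const g * iso_value U0 s = iso_const a.
Proof.
move=> Up; have [W [a [g [Wp sE]]]] := subring_typeP s (spec_point Up).
have [ng _] := sE (spec_point Up) Wp; exists g => //; exists a.
pose W' := opensI U W; have W'0 : (W' : set (spectrum R)) !=set0 by exists p.
have W'U : (W' : set (spectrum R)) `<=` U := @opensIl _ U W.
rewrite -(iso_value_restr U0 W'0 W'U) -!(iso_constE W'0) -iso_valueM.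
congr iso_value; apply: val_inj; apply: functional_extensionality_dep => q.
have [nq sq] := sE (incl_point W'U q) (proj2 (set_mem (valP q))).
have n1q := prime_complM (@prime_compl1 _ (val q)) nq.
rewrite [LHS](_ : _ = mkfrac g (@prime_compl1 _ (val q)) * mkfrac a nq); last first.
  by rewrite -sq.
by rewrite (mkfracM _ _ _ _ n1q); apply: mkfrac_eq; ring.
Qed.

(** The [g] for which [g x] comes from [R] form an ideal; as [x] is locally a fraction, this ideal
    lies in no prime, so it contains 1. *)
Lemma iso_const_surj (x : F) : A x -> exists a, x = iso_const a.
Proof.
move=> Ax; have [s sx] : exists s, iso_value specT0 s = x.
  apply: iso_value_surj => V _; apply: (subring_bigcap_sub AZ) Ax.
  exact: set_mem (valP V).
pose J := [set g | exists a, iso_const g * x = iso_const a].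
suff [a e] : J 1 by exists a; rewrite -e iso_const1 mul1r.
apply: ideal_in_no_prime.
  split.
  - exists 0; suff -> : iso_const 0 = 0 by rewrite mul0r.
    by apply: (addrI (iso_const 0)); rewrite -iso_constD !addr0.
  - move=> g h [a ga] [b hb]; exists (a + b).
    by rewrite !iso_constD mulrDl ga hb.
  - by move=> c g [a ga]; exists (c * a); rewrite !iso_constM -mulrA ga.
by move=> p; have [g ng [a ga]] := @iso_value_fraction _ specT0 s p I;
  exists g => //; exists a; rewrite -sx.
Qed.

Definition iso_const_elt (r : R) : A := subring_elt (iso_const_sub r).

Lemma iso_const_prime (P : spectrum A) : prime_ideal [set r | P (iso_const_elt r)].
Proof.
have [[P0 PD PM] P1 Pprime] := Defs.primeP P.
have eM r t : iso_const_elt (r * t) = iso_const_elt r * iso_const_elt t.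
  by apply: val_inj; rewrite rmorphM /= iso_constM.
split=> [|/=|r t /=].
- split=> [/=|r t /= Pr Pt|r t /= Pt].
  + suff -> : iso_const_elt 0 = 0 by [].
    apply: val_inj; rewrite rmorph0 /=.
    by apply: (addrI (iso_const 0)); rewrite -iso_constD !addr0.
  + suff -> : iso_const_elt (r + t) = iso_const_elt r + iso_const_elt t.
      exact: PD.
    by apply: val_inj; rewrite rmorphD /= iso_constD.
  + by rewrite eM; exact: PM.
- suff -> : iso_const_elt 1 = 1 by [].
  by apply: val_inj; rewrite rmorph1 /= iso_const1.
- by rewrite eM; exact: Pprime.
Qed.

Lemma localize_in_affine (P : spectrum A) :
  exists2 V, Z V & (V : set F) = localize P.
Proof.
pose p := Prime (iso_const_prime P); pose V := iso_inv phi p.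
have pV : iso_map phi V = p by exact: iso_invK.
have ZV : Z (val V) := set_mem (valP V).
exists (val V) => //; apply/seteqP; split=> x.
  (* An element [x] of [V] is a section over the rings containing [x]; carried to the spectrum, it
     is a fraction near [p] with denominator outside [p]. *)
  move=> Vx; pose U := opens_preim iso_inv_cont (elt_opens Z x).
  have Up : U p by [].
  have U0 : (U : set (spectrum R)) !=set0 by exists p.
  have [s sx] : exists s, iso_value U0 s = x.
    by apply: iso_value_surj => W; rewrite /= iso_mapK.
  have [g ng [a]] := iso_value_fraction U0 s Up.
  rewrite sx => gxa; exists (iso_const_elt a), (iso_const_elt g); split=> //.
  have g0 := spectrum_compl_neq0 (ng : ~ P (iso_const_elt g)).
  by rewrite /= -gxa mulrAC divff // mul1r.
case=> a [t [nt ->]]; apply: subringM.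
  exact: (subring_bigcap_sub AZ ZV (subring_typeP a)).
have [g gE] := iso_const_surj (subring_typeP t).
have tg : t = iso_const_elt g by exact: val_inj.
have pg : ~ p g by rewrite /= -tg.
(* As [g] is invertible on its basic open set, which contains [p], the inverse of [t] is the value
   of a section there and so lies in [V]. *)
pose U := Open (open_spec_basic g).
have U0 : (U : set (spectrum R)) !=set0 by exists p.
have invg : spec_sections U
    (fun q => mkfrac 1 (set_mem (valP q) : ~ val q g)).
  by move=> q; exists U, 1, g; split=> [|r Ur]; [exact: set_mem (valP q)|eexists].
have e : iso_const g * iso_value U0 (subring_elt invg) = 1.
  rewrite -(iso_constE U0) -iso_valueM -[RHS](iso_value1 U0).
  congr iso_value; apply: val_inj; apply: functional_extensionality_dep => q.
  have nq : ~ val q g := set_mem (valP q).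
  have n1q := prime_complM (@prime_compl1 _ (val q)) nq.
  rewrite [LHS](mkfracM _ _ _ _ n1q) -[RHS](mkfrac1 (@prime_compl1 _ (val q))).
  by apply: mkfrac_eq; ring.
have -> : (val t)^-1 = iso_value U0 (subring_elt invg).
  have g0 : iso_const g != 0 by rewrite -gE; exact: spectrum_compl_neq0 nt.
  by rewrite gE; apply: (mulfI g0); rewrite divff // e.
by apply: iso_value_sub; rewrite pV.
Qed.

End AffineLocalization.

(** Elements of a localization are fractions over [A], and so are their inverses. *)
Lemma localize_total_quotient_field (F : fieldType) (A : subring F)
    (P : spectrum A) :
  (forall x, localize P x \/ localize P x^-1) -> quotient_field A = setT.
Proof.
move=> tot; apply/seteqP; split=> // x _.
have [[a [s [ns ->]]]|[a [s [ns e]]]] := tot x.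
  exists (val a), (val s); rewrite (spectrum_compl_neq0 ns).
  by split=> //; exact: subring_typeP.
have [->|x0] := eqVneq x 0.
  exists 0, 1; rewrite oner_neq0 mul0r.
  by split=> //; [exact: subring0|exact: subring1].
exists (val s), (val a); rewrite -invf_div -e invrK.
split=> //; try exact: subring_typeP.
apply: contra_neq x0 => a0; move: e.
by rewrite a0 mul0r => /eqP; rewrite invr_eq0 => /eqP.
Qed.

Theorem theorem6p1 (F : fieldType) (D : subring F) (Z : set (zr_space D))
    (Z0 : Z !=set0) :
  affine_scheme (zr_presheaf Z) <->
  [/\ inverse_closed Z,
      prufer_domain (zr_sections (opensT (set_type Z))) &
      quotient_field (zr_sections (opensT (set_type Z))) = setT].
Proof.
have AZ := zr_sectionsT Z; set A := zr_sections _ in AZ *.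
split=> [[_ [R [phi]]]|[invZ pruferA quotA]]; last first.
  apply: (zr_affine AZ) => [P x|P]; first exact: prufer_total.
  exact: (localize_in_inverse_closed AZ Z0).
have locZ := localize_in_affine Z0 phi AZ.
have totA (P : spectrum A) x : localize P x \/ localize P x^-1.
  by have [V _ <-] := locZ P; exact: zr_total.
split.
- apply/seteqP; split=> [V ZV U [_ _]|W HW]; first exact.
  (* For [x] in [A], the basic open set of [x] is quasicompact and contains [Z], hence also contains
     [W]. *)
  have AW : (A : set F) `<=` W.
    move=> x Ax; apply: (HW (zr_basic [set x])) => //; split.
    + exact/open_zr_basic/finite_set1.
    + exact: compact_zr_basic.
    + by move=> V ZV _ ->; exact: (subring_bigcap_sub AZ ZV).
  have [V ZV VE] := locZ (center AW).
  by rewrite (_ : W = V) //; apply: zr_eq; rewrite VE localize_center.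
- by move=> P x _ _; exact: totA.
- exact: (localize_total_quotient_field (totA (zero_ideal A))).
Qed.
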